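(* Let $g\in L^\infty[-1/2,1/2]$ and let $\mathcal F(g)=\{e^{2\pi i n x}: n\in\mathbb N_0\}\cup\{g(x)e^{2\pi i n x}: n\in\mathbb N^-\}$. Then: (1) $\mathcal F(g)$ is complete in $L^2[-1/2,1/2]$ if and only if the Toeplitz operator $T_g$ is injective (i.e. $0\notin\sigma_p(T_g)$); (2) $\mathcal F(g)$ is a frame for $L^2[-1/2,1/2]$ if and only if $T_g$ is bounded and bounded below (i.e. $0\notin\sigma_{ap}(T_g)$); (3) $\mathcal F(g)$ is a Riesz basis for $L^2[-1/2,1/2]$ if and only if $T_g$ is bounded and invertible (i.e. $0\notin\sigma(T_g)$).
   Context: $\mathbb N_0=\{0,1,2,\dots\}$, $\mathbb N^-=\{-1,-2,\dots\}$. For $\phi\in L^1[-1/2,1/2]$, $\widehat\phi(n)=\int_{-1/2}^{1/2}\phi(x)e^{-2\pi i n x}\,dx$. Let $\tilde H^2=\{f\in L^2[-1/2,1/2]:\widehat f(n)=0 \text{ for all } n\in\mathbb N^-\}$ and $P_+$ the orthogonal projection of $L^2[-1/2,1/2]$ onto $\tilde H^2$. For $\phi\in L^\infty[-1/2,1/2]$ the Toeplitz operator $T_\phi:\tilde H^2\to\tilde H^2$ is $T_\phi f=P_+(\phi f)$; in the basis $\{e^{2\pi i n x}\}_{n\in\mathbb N_0}$ its matrix has $(j,k)$ entry $\widehat\phi(j-k)$ ($j,k\in\mathbb N_0$), so it may be viewed as an operator on $\ell^2(\mathbb N_0)$. A family $\{h_k\}$ in a Hilbert space $H$ is complete if $\langle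 f,h_k\rangle=0$ for all $k$ implies $f=0$; it is a frame if there are $0<A\le B<\infty$ with $A\|f\|^2\le\sum_k|\langle f,h_k\rangle|^2\le B\|f\|^2$ for all $f\in H$; it is a Riesz basis if it is a frame and every $f\in H$ has a unique expansion $f=\sum_k\alpha_k h_k$. An operator $T$ is bounded below if there is $c>0$ with $\|Tf\|\ge c\|f\|$ for all $f$. $\sigma_p$, $\sigma_{ap}$, $\sigma$ denote point spectrum, approximate point spectrum and spectrum. *)

(* Defs.v *)
(* MathComp + MathComp-Analysis, complex numbers from mathcomp-real-closed. *)
From HB Require Import structures.
From mathcomp Require Import all_boot all_order all_algebra.
From mathcomp Require Import all_classical all_reals all_analysis.
From mathcomp Require Import complex.
Set Implicit Arguments. Unset Strict Implicit. Unset Printing Implicit Defensive.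
Import Order.TTheory GRing.Theory Num.Theory.
Local Open Scope classical_set_scope.
Local Open Scope ring_scope.

Section Defs.
Variable R : realType.
Local Notation C := R[i].
Local Notation mu := (@lebesgue_measure R).

(* the domain [-1/2, 1/2] *)
Definition I0 : set R := `[(- (1/2)) , 1/2]%classic.

(* |z|^2 as a real number *)
Definition nsq (z : C) : R := complex.Re z ^+ 2 + complex.Im z ^+ 2.

(* Lebesgue integral over [-1/2,1/2] of a complex-valued function,
   defined componentwise *)
Definition cint (f : R -> C) : C :=
  Complex (Rintegral mu I0 (fun x => complex.Re (f x)))
          (Rintegral mu I0 (fun x => complex.Im (f x))).

Definition cmeasurable (f : R -> C) : Prop :=
  measurable_fun I0 (fun x => complex.Re (f x)) /\
  measurable_fun I0 (fun x => complex.Im (f x)).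

(* f is in L^2[-1/2,1/2] *)
Definition L2 (f : R -> C) : Prop :=
  cmeasurable f /\ mu.-integrable I0 (fun x => (nsq (f x))%:E).

(* g is in L^oo[-1/2,1/2] *)
Definition Linf (g : R -> C) : Prop :=
  cmeasurable g /\
  exists M : R, {ae mu, forall x, I0 x -> nsq (g x) <= M}.

(* f = 0 in L^2 (i.e. almost everywhere on [-1/2,1/2]) *)
Definition ae_zero (f : R -> C) : Prop := {ae mu, forall x, I0 x -> f x = 0}.
Definition ae_eq (f h : R -> C) : Prop := {ae mu, forall x, I0 x -> f x = h x}.

(* inner product <f,h> = int f conj(h) *)
Definition inner (f h : R -> C) : C := cint (fun x => f x * (h x)^*).

(* L^2 norm *)
Definition l2norm (f : R -> C) : R := Num.sqrt (Rintegral mu I0 (fun x => nsq (f x))).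

(* e_n(x) = exp(2 pi i n x) *)
Definition expn (n : int) (x : R) : C :=
  Complex (cos (2 * pi * n%:~R * x)) (sin (2 * pi * n%:~R * x)).

(* Fourier coefficient \hat phi(n) = <phi, e_n> *)
Definition fcoef (phi : R -> C) (n : int) : C := inner phi (expn n).

(* tilde H^2 *)
Definition H2 (f : R -> C) : Prop :=
  L2 f /\ forall n : int, n < 0 -> fcoef f n = 0.

(* u = P_+ h : the orthogonal projection of h onto tilde H^2 *)
Definition is_Pplus (h u : R -> C) : Prop :=
  H2 u /\ forall v, H2 v -> inner (fun x => h x - u x) v = 0.

(* u = T_g f = P_+ (g f) *)
Definition toeplitz (g f u : R -> C) : Prop := is_Pplus (fun x => g x * f x) u.

Definition toeplitz_injective (g : R -> C) : Prop :=
  forall f u, H2 f -> toeplitz g f u -> ae_zero u -> ae_zero f.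

Definition toeplitz_bounded (g : R -> C) : Prop :=
  exists K : R, forall f u, H2 f -> toeplitz g f u -> l2norm u <= K * l2norm f.

Definition toeplitz_bounded_below (g : R -> C) : Prop :=
  exists c : R, 0 < c /\
    forall f u, H2 f -> toeplitz g f u -> c * l2norm f <= l2norm u.

(* T_g has a bounded two-sided inverse S on tilde H^2 *)
Definition toeplitz_invertible (g : R -> C) : Prop :=
  exists S : (R -> C) -> (R -> C),
    (forall u, H2 u -> H2 (S u)) /\
    (exists K : R, forall u, H2 u -> l2norm (S u) <= K * l2norm u) /\
    (forall f u, H2 f -> toeplitz g f u -> ae_eq (S u) f) /\
    (forall u, H2 u -> toeplitz g (S u) u).

(* the family F(g), indexed by Z *)
Definition Fam (g : R -> C) (n : int) : R -> C :=
  if 0 <= n then expn n else (fun x => g x * expn n x).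

(* generic notions for a family h indexed by int in L^2[-1/2,1/2] *)
Definition complete_fam (h : int -> R -> C) : Prop :=
  forall f, L2 f -> (forall n, inner f (h n) = 0) -> ae_zero f.

Definition frame_fam (h : int -> R -> C) : Prop :=
  exists A B : R, 0 < A /\ A <= B /\
    forall f, L2 f ->
      ((A * l2norm f ^+ 2)%:E <= \esum_(n in [set: int]) (nsq (inner f (h n)))%:E)%E /\
      (\esum_(n in [set: int]) (nsq (inner f (h n)))%:E <= (B * l2norm f ^+ 2)%:E)%E.

(* f = sum_n alpha_n h_n, the series converging (unconditionally) in L^2 *)
Definition expansion (h : int -> R -> C) (alpha : int -> C) (f : R -> C) : Prop :=
  forall eps : R, 0 < eps -> exists F0 : seq int,
    forall F : seq int, uniq F -> {subset F0 <= F} ->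
      l2norm (fun x => f x - \sum_(n <- F) alpha n * h n x) < eps.

Definition riesz_basis_fam (h : int -> R -> C) : Prop :=
  frame_fam h /\
  forall f, L2 f -> exists alpha, expansion h alpha f /\
    forall beta, expansion h beta f -> beta = alpha.

End Defs.

(* Main.v *)
(** Write [e_n] for the exponentials. The antilinear isometry
    [flip f = conj (e_1 f)] of [L^2] sends [e_n] to [e_(-n-1)], hence exchanges
    [H2] with its orthogonal complement, and the coefficients of [flip f] against
    the family are [0] for [n >= 0] and [conj (T_g f)^(-n-1)] for [n < 0]. So on
    the complement of [H2] the analysis operator of the family is [T_g], and on
    [H2] it contains the Fourier coefficients; this gives (1) and (2).

    For (3), an expansion of [f] in the family is a splitting [f = h + g w] with
    [h] in [H2] and [w] orthogonal to [H2]; existence and uniqueness of [w] are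
    surjectivity and injectivity of the adjoint [T_(conj g)]. If [T_g] is bounded
    below its range is closed, with orthogonal complement [ker T_(conj g)], so
    [T_g] bounded below and [T_(conj g)] injective amount to invertibility.

    Completeness of the exponentials: a function orthogonal to all of them has
    integral [0] against [(1 - t^n)^(2^n)] for every trigonometric [t] with values
    in [[0, 1]]; a suitable [t] makes these converge to the indicator of a given
    ball, and Lebesgue differentiation concludes. *)
Require Import Defs.
From mathcomp Require Import all_boot all_order all_algebra.
From mathcomp Require Import all_classical all_reals all_analysis.
From mathcomp Require Import complex measurable_realfun ring lra zify.
Set Implicit Arguments. Unset Strict Implicit. Unset Printing Implicit Defensive.
Import Order.TTheory GRing.Theory Num.Theory.
Import numFieldNormedType.Exports.
Local Open Scope classical_set_scope.
Local Open Scope ring_scope.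

(** * The Hilbert space [L2] *)

Section L2.
Variable R : realType.
Local Notation C := R[i].
Local Notation fn := (R -> C).
Local Notation mu := (@lebesgue_measure R).
Local Notation Re := complex.Re.
Local Notation Im := complex.Im.
Implicit Types (f g h : fn) (z w : C).

Lemma aeS (P Q : R -> Prop) : {ae mu, forall x, P x} -> (forall x, P x -> Q x) ->
  {ae mu, forall x, Q x}.
Proof. by move=> aeP PQ; exact: (@filterS _ _ (ae_filter_ringOfSetsType mu) _ _ PQ aeP). Qed.

Lemma ae_and (P Q : R -> Prop) : {ae mu, forall x, P x} -> {ae mu, forall x, Q x} ->
  {ae mu, forall x, P x /\ Q x}.
Proof.
have PQ x : P x -> Q x -> P x /\ Q x by [].
by move=> aeP aeQ; exact: (@filterS2 _ _ (ae_filter_ringOfSetsType mu) _ _ _ PQ aeP aeQ).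
 Qed.

Lemma ReM z w : Re (z * w) = Re z * Re w - Im z * Im w.
Proof. by case: z w => [a b] [c d]. Qed.

Lemma ImM z w : Im (z * w) = Re z * Im w + Im z * Re w.
Proof. by case: z w => [a b] [c d]. Qed.

Lemma Re_conjc z : Re z^* = Re z. Proof. by case: z. Qed.

Lemma Im_conjc z : Im z^* = - Im z. Proof. by case: z. Qed.

Definition ReImE := (ReM, ImM, Re_conjc, Im_conjc, raddfD, raddfB, raddfN).

Lemma complexP z w : Re z = Re w -> Im z = Im w -> z = w.
Proof. by case: z w => [a b] [c d] /= -> ->. Qed.

Lemma nsq_ge0 z : 0 <= nsq z.
Proof. by rewrite /nsq addr_ge0 ?sqr_ge0. Qed.

Lemma nsqM z w : nsq (z * w) = nsq z * nsq w.
Proof. rewrite /nsq !ReImE; ring. Qed.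

Lemma nsq_conj z : nsq z^* = nsq z.
Proof. by rewrite /nsq !ReImE sqrrN. Qed.

Lemma nsqD_le z w : nsq (z + w) <= 2 * nsq z + 2 * nsq w.
Proof.
rewrite /nsq !ReImE -subr_ge0.
have -> : 2 * (Re z ^+ 2 + Im z ^+ 2) + 2 * (Re w ^+ 2 + Im w ^+ 2) -
  ((Re z + Re w) ^+ 2 + (Im z + Im w) ^+ 2) =
  (Re z - Re w) ^+ 2 + (Im z - Im w) ^+ 2 by ring.
by rewrite addr_ge0 ?sqr_ge0.
Qed.

Lemma nsq_eq0 z : nsq z = 0 -> z = 0.
Proof.
move=> /eqP; rewrite /nsq paddr_eq0 ?sqr_ge0// !sqrf_eq0 => /andP[/eqP a0 /eqP b0].
exact: complexP.
Qed.

Lemma nsq0 : nsq (0 : C) = 0.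
Proof. by rewrite /nsq /= expr0n addr0. Qed.

Lemma measurable_I0 : measurable (@I0 R).
Proof. exact: measurable_itv. Qed.
Hint Resolve measurable_I0 : core.

Lemma mu_I0 : mu (@I0 R) = 1%:E.
Proof.
rewrite /I0 lebesgue_measure_itv /= lte_fin ifT; last by lra.
by rewrite -EFinD; congr EFin; lra.
Qed.

(** * Measurability and integration of complex-valued functions *)

Lemma cmeasurableD f g : cmeasurable f -> cmeasurable g -> cmeasurable (f + g).
Proof.
move=> [f1 f2] [g1 g2]; split.
  rewrite (_ : (fun x => _) = (fun x => Re (f x)) \+ (fun x => Re (g x))).
    exact: measurable_funD.
  by apply/funext => x; rewrite !ReImE.
rewrite (_ : (fun x => _) = (fun x => Im (f x)) \+ (fun x => Im (g x))).
  exact: measurable_funD.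
by apply/funext => x; rewrite !ReImE.
Qed.

Lemma cmeasurableM f g : cmeasurable f -> cmeasurable g -> cmeasurable (f * g).
Proof.
move=> [f1 f2] [g1 g2]; split.
  rewrite (_ : (fun x => _) = ((fun x => Re (f x)) \* (fun x => Re (g x))) \-
     ((fun x => Im (f x)) \* (fun x => Im (g x)))).
    by apply: measurable_funB; apply: measurable_funM.
  by apply/funext => x; rewrite !ReImE.
rewrite (_ : (fun x => _) = ((fun x => Re (f x)) \* (fun x => Im (g x))) \+
     ((fun x => Im (f x)) \* (fun x => Re (g x)))).
  by apply: measurable_funD; apply: measurable_funM.
by apply/funext => x; rewrite !ReImE.
Qed.

Definition conjf f : fn := fun x => (f x)^*.

Lemma cmeasurable_conj f : cmeasurable f -> cmeasurable (conjf f).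
Proof.
move=> [f1 f2]; split.
  by under eq_fun do rewrite Re_conjc.
under eq_fun do rewrite Im_conjc.
exact: measurableT_comp.
Qed.

Lemma cmeasurable_cst z : cmeasurable (cst z : fn).
Proof. by split; apply: measurable_cst. Qed.

Lemma measurable_nsq f : cmeasurable f -> measurable_fun (@I0 R) (fun x => nsq (f x)).
Proof.
move=> [f1 f2]; rewrite /nsq.
by apply: measurable_funD; apply: measurable_funX.
Qed.

Lemma conjfM f g : conjf (f * g) = conjf f * conjf g.
Proof. by apply/funext => x; rewrite /conjf rmorphM. Qed.

Lemma conjfK : involutive conjf.
Proof. by move=> f; apply/funext => x; rewrite /conjf conjCK. Qed.

Definition cintegrable f := mu.-integrable (@I0 R) (EFin \o (fun x => Re (f x))) /\
  mu.-integrable (@I0 R) (EFin \o (fun x => Im (f x))).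

Lemma integrableZ_EFin (k : R) (u : R -> R) : mu.-integrable (@I0 R) (EFin \o u) ->
  mu.-integrable (@I0 R) (EFin \o (fun x => k * u x)).
Proof.
move=> iu; rewrite (_ : _ \o _ = (fun x => k%:E * (EFin \o u) x)%E).
  exact: integrableZl.
by apply/funext => x /=; rewrite EFinM.
Qed.

Lemma integrableD_EFin (u v : R -> R) : mu.-integrable (@I0 R) (EFin \o u) ->
  mu.-integrable (@I0 R) (EFin \o v) ->
  mu.-integrable (@I0 R) (EFin \o (fun x => u x + v x)).
Proof.
move=> iu iv; rewrite (_ : _ \o _ = (EFin \o u) \+ (EFin \o v))%E; last by [].
exact: integrableD.
Qed.

Lemma cintD f g : cintegrable f -> cintegrable g -> cint (f + g) = cint f + cint g.
Proof.
move=> [f1 f2] [g1 g2]; rewrite /cint; apply: complexP; rewrite /= -RintegralD//;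
  by congr (Rintegral _ _ _); apply/funext => x; rewrite /= !ReImE.
Qed.

Lemma cintZ z f : cintegrable f -> cint (cst z * f) = z * cint f.
Proof.
move=> [f1 f2]; rewrite /cint; apply: complexP; rewrite !ReImE /= -!RintegralZl//.
  rewrite -RintegralB//; try exact: integrableZ_EFin.
  by congr (Rintegral _ _ _); apply/funext => x; rewrite /= !ReImE.
rewrite -RintegralD//; try exact: integrableZ_EFin.
by congr (Rintegral _ _ _); apply/funext => x; rewrite /= !ReImE.
Qed.

Lemma cint_conj f : cintegrable f -> cint (conjf f) = (cint f)^*.
Proof.
move=> [f1 f2]; rewrite /cint; apply: complexP; rewrite !ReImE /=.
  by congr (Rintegral _ _ _); apply/funext => x; rewrite /conjf !ReImE.
rewrite -mulN1r -RintegralZl//.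
by congr (Rintegral _ _ _); apply/funext => x; rewrite /conjf !ReImE mulN1r.
Qed.

Lemma le_integrable_EFin (u v : R -> R) : measurable_fun (@I0 R) u ->
  mu.-integrable (@I0 R) (EFin \o v) -> (forall x, `|u x| <= v x) ->
  mu.-integrable (@I0 R) (EFin \o u).
Proof.
move=> mfu iv uv; apply: (le_integrable _ _ _ iv) => //.
  exact/measurable_EFinP.
by move=> x _ /=; rewrite lee_fin (le_trans (uv x))// ler_norm.
Qed.

Lemma EFin_Rintegral (u : R -> R) : mu.-integrable (@I0 R) (EFin \o u) ->
  (Rintegral mu (@I0 R) u)%:E = (\int[mu]_(x in @I0 R) (u x)%:E)%E.
Proof. by move=> iu; rewrite fineK//; exact: integrable_fin_num. Qed.

Lemma L2M_cintegrable f g : L2 f -> L2 g -> cintegrable (f * g).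
Proof.
move=> [mf f2] [mg g2].
have [m1 m2] := cmeasurableM mf mg.
have ifg := integrableD_EFin f2 g2.
(* One inequality serves both components: [a * c - b * d] is the real part of the product, and it
   becomes the imaginary part after replacing [b] by [- b] and exchanging [c] and [d]. *)
have ler2 (a b c d : R) : `|a * c - b * d| <= a ^+ 2 + b ^+ 2 + (c ^+ 2 + d ^+ 2).
  rewrite ler_norml -subr_ge0 -[X in _ && X]subr_ge0; apply/andP; split.
    have -> : a * c - b * d - - (a ^+ 2 + b ^+ 2 + (c ^+ 2 + d ^+ 2)) =
      (a + c / 2) ^+ 2 + (b - d / 2) ^+ 2 + (3 / 4) * (c ^+ 2 + d ^+ 2) by field.
    by rewrite !addr_ge0// ?sqr_ge0// mulr_ge0// ?addr_ge0 ?sqr_ge0//.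
  have -> : a ^+ 2 + b ^+ 2 + (c ^+ 2 + d ^+ 2) - (a * c - b * d) =
      (a - c / 2) ^+ 2 + (b + d / 2) ^+ 2 + (3 / 4) * (c ^+ 2 + d ^+ 2) by field.
  by rewrite !addr_ge0// ?sqr_ge0// mulr_ge0// ?addr_ge0 ?sqr_ge0//.
split; apply: (le_integrable_EFin _ ifg) => // x; rewrite /nsq /= !ReImE.
  exact: ler2.
have := ler2 (Re (f x)) (- Im (f x)) (Im (g x)) (Re (g x)).
by rewrite mulNr opprK sqrrN [Im (g x) ^+ 2 + _]addrC.
Qed.

Lemma L2_conj f : L2 f -> L2 (conjf f).
Proof.
move=> [mf f2]; split; first exact: cmeasurable_conj.
by under eq_fun do rewrite /conjf nsq_conj.
Qed.

Lemma L2D f g : L2 f -> L2 g -> L2 (f + g).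
Proof.
move=> [mf f2] [mg g2]; split; first exact: cmeasurableD.
apply: (@le_integrable_EFin _ (fun x => 2 * nsq (f x) + 2 * nsq (g x))).
- exact: measurable_nsq (cmeasurableD mf mg).
- by apply: integrableD_EFin; apply: integrableZ_EFin.
- by move=> x; rewrite ger0_norm ?nsq_ge0// nsqD_le.
Qed.

Lemma L2Z z f : L2 f -> L2 (cst z * f).
Proof.
move=> [mf f2]; split; first by apply: cmeasurableM => //; exact: cmeasurable_cst.
rewrite (_ : (fun x => _) = EFin \o (fun x => nsq z * nsq (f x))).
  exact: integrableZ_EFin.
by apply/funext => x /=; rewrite nsqM.
Qed.

Lemma oppfE f : - f = cst (-1) * f.
Proof. by apply/funext => x; rewrite -[RHS]/(-1 * f x) mulN1r. Qed.

Lemma L2N f : L2 f -> L2 (- f).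
Proof. by move=> ?; rewrite oppfE; exact: L2Z. Qed.

Lemma L2B f g : L2 f -> L2 g -> L2 (f - g).
Proof. by move=> ? ?; apply/L2D => //; exact/L2N. Qed.

Lemma L20 : L2 (0 : fn).
Proof.
split; first exact: cmeasurable_cst.
rewrite (_ : (fun x => _) = cst 0%E); first exact: integrable0.
by apply/funext => x; rewrite nsq0.
Qed.

Lemma L2_sum (I : Type) (s : seq I) (F : I -> fn) :
  (forall i, L2 (F i)) -> L2 (\sum_(i <- s) F i).
Proof.
move=> LF; elim: s => [|i s IH]; first by rewrite big_nil; exact: L20.
by rewrite big_cons; exact: L2D.
Qed.

(** * Inner product and norm *)

Lemma innerE f g : inner f g = cint (f * conjf g). Proof. by []. Qed.

Lemma inner_conj f g : L2 f -> L2 g -> inner g f = (inner f g)^*.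
Proof.
move=> Lf Lg; rewrite !innerE -cint_conj; last exact/L2M_cintegrable/L2_conj.
by rewrite conjfM conjfK mulrC.
Qed.

Lemma innerDl f g h : L2 f -> L2 g -> L2 h -> inner (f + g) h = inner f h + inner g h.
Proof.
by move=> Lf Lg Lh; rewrite !innerE mulrDl cintD//; exact/L2M_cintegrable/L2_conj.
Qed.

Lemma innerZl z f h : L2 f -> L2 h -> inner (cst z * f) h = z * inner f h.
Proof.
by move=> Lf Lh; rewrite !innerE -mulrA cintZ//; exact/L2M_cintegrable/L2_conj.
Qed.

Lemma innerNl f h : L2 f -> L2 h -> inner (- f) h = - inner f h.
Proof. by move=> Lf Lh; rewrite oppfE innerZl// mulN1r. Qed.

Lemma innerBl f g h : L2 f -> L2 g -> L2 h -> inner (f - g) h = inner f h - inner g h.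
Proof. by move=> Lf Lg Lh; rewrite innerDl ?innerNl//; exact: L2N. Qed.

Lemma inner0l h : inner 0 h = 0.
Proof.
rewrite innerE mul0r /cint /=; apply: complexP => /=;
 by rewrite (@eq_Rintegral _ _ _ _ _ (cst 0)) ?Rintegral_cst ?mul0r//.
Qed.

Lemma innerDr f g h : L2 f -> L2 g -> L2 h -> inner f (g + h) = inner f g + inner f h.
Proof.
move=> Lf Lg Lh; rewrite inner_conj//; last exact: L2D.
by rewrite innerDl// rmorphD /= -(inner_conj Lg Lf) -(inner_conj Lh Lf).
Qed.

Lemma innerZr z f h : L2 f -> L2 h -> inner f (cst z * h) = z^* * inner f h.
Proof.
move=> Lf Lh; rewrite inner_conj//; last exact: L2Z.
by rewrite innerZl// rmorphM /= -(inner_conj Lh Lf).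
Qed.

Lemma innerNr f h : L2 f -> L2 h -> inner f (- h) = - inner f h.
Proof. by move=> Lf Lh; rewrite oppfE innerZr// rmorphN rmorph1 mulN1r. Qed.

Lemma innerBr f g h : L2 f -> L2 g -> L2 h -> inner f (g - h) = inner f g - inner f h.
Proof. by move=> Lf Lg Lh; rewrite innerDr ?innerNr//; exact: L2N. Qed.

Lemma inner_suml (I : Type) (s : seq I) (F : I -> fn) h :
  (forall i, L2 (F i)) -> L2 h ->
  inner (\sum_(i <- s) F i) h = \sum_(i <- s) inner (F i) h.
Proof.
move=> LF Lh; elim: s => [|i s IH]; first by rewrite !big_nil inner0l.
by rewrite !big_cons innerDl// ?IH//; exact: L2_sum.
Qed.

Lemma inner_sumr (I : Type) (s : seq I) (F : I -> fn) h :
  (forall i, L2 (F i)) -> L2 h ->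
  inner h (\sum_(i <- s) F i) = \sum_(i <- s) inner h (F i).
Proof.
move=> LF Lh; rewrite inner_conj//; last exact: L2_sum.
rewrite inner_suml// rmorph_sum; apply: eq_bigr => i _.
by rewrite /= -(inner_conj (LF i) Lh).
Qed.

Definition sqn f : R := Rintegral mu (@I0 R) (fun x => nsq (f x)).

Lemma sqn_ge0 f : 0 <= sqn f.
Proof. by apply: Rintegral_ge0 => x _; exact: nsq_ge0. Qed.

Lemma EFin_sqn f : L2 f -> (sqn f)%:E = (\int[mu]_(x in @I0 R) (nsq (f x))%:E)%E.
Proof. by case=> _; exact: EFin_Rintegral. Qed.

Lemma sqr_l2norm f : l2norm f ^+ 2 = sqn f.
Proof. by rewrite sqr_sqrtr// sqn_ge0. Qed.

Lemma l2norm_ge0 f : 0 <= l2norm f.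
Proof. exact: sqrtr_ge0. Qed.

Lemma Re_inner_self f : Re (inner f f) = sqn f.
Proof.
by congr (Rintegral _ _ _); apply/funext => x; rewrite !ReImE /nsq; ring.
Qed.

Lemma inner_self f : inner f f = (sqn f)%:C%C.
Proof.
apply: complexP; first exact: Re_inner_self.
rewrite /= (@eq_Rintegral _ _ _ _ _ (cst 0)) ?Rintegral_cst ?mul0r// => x _.
by rewrite !ReImE /=; ring.
Qed.

Lemma sqnD f g : L2 f -> L2 g -> sqn (f + g) = sqn f + sqn g + 2 * Re (inner f g).
Proof.
move=> Lf Lg; rewrite -!Re_inner_self innerDl//; last exact: L2D.
rewrite !innerDr// (inner_conj Lf Lg) !ReImE; ring.
Qed.

Lemma sqnZ z f : L2 f -> sqn (cst z * f) = nsq z * sqn f.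
Proof.
move=> Lf; rewrite -!Re_inner_self innerZl// ?innerZr//; last exact: L2Z.
by rewrite mulrA inner_self /nsq !ReImE /=; ring.
Qed.

Lemma sqnN f : sqn (- f) = sqn f.
Proof.
congr (Rintegral _ _ _); apply/funext => x.
by rewrite /nsq -[(- f) x]/(- (f x)) !ReImE !sqrrN.
Qed.

Lemma sqnB f g : L2 f -> L2 g -> sqn (f - g) = sqn f + sqn g - 2 * Re (inner f g).
Proof.
move=> Lf Lg; rewrite sqnD//; last exact: L2N.
by rewrite sqnN innerNr// !ReImE mulrN.
Qed.

Lemma l2normN f : l2norm (- f) = l2norm f.
Proof. by rewrite /l2norm -!/(sqn _) sqnN. Qed.

(* Test the nonnegative quadratic [sqn (|g|^2 f - <f,g> g)]. *)
Lemma cauchy_schwarz f g : L2 f -> L2 g -> nsq (inner f g) <= sqn f * sqn g.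
Proof.
move=> Lf Lg; set z := inner f g.
have := sqn_ge0 (cst (sqn g)%:C%C * f - cst z * g).
rewrite sqnB; try exact: L2Z.
rewrite !sqnZ// innerZl//; last exact: L2Z.
rewrite innerZr// -/z.
have -> : nsq (sqn g)%:C%C = sqn g ^+ 2 by rewrite /nsq /= expr0n addr0.
have -> : Re ((sqn g)%:C%C * (z^* * z)) = sqn g * nsq z.
  by rewrite !ReImE /nsq /=; ring.
move=> H; have := sqn_ge0 g; rewrite le_eqVlt => /predU1P[g0|g0].
  (* For [sqn g = 0] the quadratic above gives nothing. If [z] were nonzero, [k] would make
     [sqn (f - k z g)] equal to [sqn f - 2 (sqn f + 1)], which is negative. *)
  rewrite -g0 mulr0.
  rewrite leNgt; apply/negP => z0; pose k := (sqn f + 1) / nsq z.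
  have := sqn_ge0 (f - cst (k%:C%C * z) * g).
  rewrite sqnB//; last exact: L2Z.
  rewrite sqnZ// -g0 mulr0 addr0 innerZr// -/z.
  have -> : Re ((k%:C%C * z)^* * z) = k * nsq z.
    by rewrite !ReImE /nsq /=; ring.
  by rewrite /k divfK ?gt_eqF//; have := sqn_ge0 f; lra.
rewrite -subr_ge0 -(pmulr_rge0 _ g0).
by apply: le_trans H _; rewrite le_eqVlt; apply/orP; left; apply/eqP; ring.
Qed.

Lemma Re_inner_le f g : L2 f -> L2 g -> Re (inner f g) <= l2norm f * l2norm g.
Proof.
move=> Lf Lg; apply: (@le_trans _ _ (Num.sqrt (nsq (inner f g)))).
  rewrite /nsq (le_trans (ler_norm _))// -sqrtr_sqr ler_wsqrtr//.
  by rewrite lerDl sqr_ge0.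
by rewrite -sqrtrM ?sqn_ge0// ler_wsqrtr// cauchy_schwarz.
Qed.

Lemma l2normD f g : L2 f -> L2 g -> l2norm (f + g) <= l2norm f + l2norm g.
Proof.
move=> Lf Lg; rewrite -(@ler_pXn2r _ 2) ?nnegrE ?addr_ge0 ?l2norm_ge0//.
rewrite sqr_l2norm sqnD// sqrrD !sqr_l2norm.
by have := Re_inner_le Lf Lg; lra.
Qed.

Lemma l2normB f g : L2 f -> L2 g -> l2norm (f - g) <= l2norm f + l2norm g.
Proof.
by move=> Lf Lg; rewrite (le_trans (l2normD _ _))// ?l2normN//; exact: L2N.
Qed.

Lemma ae_zero_sqn f : L2 f -> sqn f = 0 -> ae_zero f.
Proof.
move=> Lf f0; have [mf f2] := Lf.
have mn : measurable_fun (@I0 R) (fun x => (nsq (f x))%:E).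
  by apply/measurable_EFinP; exact: measurable_nsq.
have iE : (\int[mu]_(x in @I0 R) `|(nsq (f x))%:E| = (sqn f)%:E)%E.
  rewrite EFin_sqn//; apply: eq_integral => x _.
  by rewrite gee0_abs// lee_fin nsq_ge0.
rewrite f0 in iE; move: iE => /(ae_eq_integral_abs mu measurable_I0 mn).1.
by apply: filterS => x fx0 Ix; have [] := fx0 Ix; exact: nsq_eq0.
Qed.

Lemma sqn_ae_zero f : cmeasurable f -> ae_zero f -> sqn f = 0.
Proof.
move=> mf f0; rewrite /sqn /Rintegral (@ae_eq_integral _ _ _ mu _ (cst 0%E))//.
- by rewrite integral_cst// mul0e.
- by apply/measurable_EFinP; exact: measurable_nsq.
- by apply: (aeS f0) => x fx0 Ix; rewrite fx0// nsq0.
Qed.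

Lemma l2norm_eq0 f : L2 f -> l2norm f = 0 <-> ae_zero f.
Proof.
move=> Lf; split=> [f0|/(sqn_ae_zero Lf.1) f0].
  by apply: ae_zero_sqn => //; rewrite -sqr_l2norm f0 expr0n.
by rewrite /l2norm -/(sqn f) f0 sqrtr0.
Qed.

Lemma inner_ae_zero f g : L2 f -> L2 g -> ae_zero f -> inner f g = 0.
Proof.
move=> Lf Lg f0; apply: nsq_eq0; apply/eqP; rewrite eq_le nsq_ge0 andbT.
by rewrite (le_trans (cauchy_schwarz Lf Lg))// (sqn_ae_zero Lf.1 f0) mul0r.
Qed.

Lemma ae_eq_sub f g : Defs.ae_eq f g <-> ae_zero (f - g).
Proof.
split=> fg; apply: (aeS fg) => x H Ix.
  by rewrite -[LHS]/(f x - g x) H// subrr.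
by apply/eqP; rewrite -subr_eq0; apply/eqP; exact: H.
Qed.

Lemma ae_eq_sqnP f g : L2 f -> L2 g -> Defs.ae_eq f g <-> sqn (f - g) = 0.
Proof.
move=> Lf Lg; have LB := L2B Lf Lg; split.
  by move=> /ae_eq_sub; exact: (sqn_ae_zero LB.1).
by move=> /(ae_zero_sqn LB) ?; apply/ae_eq_sub.
Qed.

Lemma Linf_mul g : Linf g -> exists M : R, 0 <= M /\ forall f, L2 f -> L2 (g * f) /\ l2norm (g * f) <= M * l2norm f.
Proof.
(* The absolute value makes the bound nonnegative without an argument about the sign of [M]. *)
move=> [mg [M gM]]; exists (Num.sqrt `|M|); split; first exact: sqrtr_ge0.
move=> f [mf f2]; have mgf := cmeasurableM mg mf.
have mn : measurable_fun (@I0 R) (fun x => (nsq ((g * f) x))%:E).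
  by apply/measurable_EFinP; exact: measurable_nsq.
pose Mf x : R := `|M| * nsq (f x).
have mMf : measurable_fun (@I0 R) (EFin \o Mf).
  by apply/measurable_EFinP; rewrite /Mf; apply: measurable_funM => //; exact: measurable_nsq.
have iMf : mu.-integrable (@I0 R) (EFin \o Mf) := integrableZ_EFin `|M| f2.
have le : (\int[mu]_(x in @I0 R) (nsq ((g * f) x))%:E <=
    \int[mu]_(x in @I0 R) (EFin \o Mf) x)%E.
  apply: ae_ge0_le_integral => //.
  - by move=> x _; rewrite lee_fin nsq_ge0.
  - by move=> x _; rewrite lee_fin mulr_ge0// nsq_ge0.
  - apply: (aeS gM) => x gMx Ix; rewrite lee_fin nsqM.
    by rewrite ler_wpM2r ?nsq_ge0// (le_trans (gMx Ix))// ler_norm.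
have Lgf : L2 (g * f).
  split => //; apply/integrableP; split => //.
  under eq_integral do rewrite gee0_abs ?lee_fin ?nsq_ge0//.
  by rewrite (le_lt_trans le)//; exact: integrable_lty.
split => //.
rewrite /l2norm -!/(sqn _) -sqrtrM// ler_wsqrtr//.
rewrite /sqn -RintegralZl// /Rintegral fine_le//.
- exact: integrable_fin_num Lgf.2.
- exact: integrable_fin_num.
Qed.

Lemma Linf_conj g : Linf g -> Linf (conjf g).
Proof.
move=> [mg [M gM]]; split; first exact: cmeasurable_conj.
by exists M; apply: (aeS gM) => x; rewrite /conjf nsq_conj.
Qed.

Lemma inner_mull g f h : inner (g * f) h = inner f (conjf g * h).
Proof. by rewrite !innerE conjfM conjfK mulrA [g * f]mulrC. Qed.

End L2.

(** * Completeness of [L2] *)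

Section L2_complete.
Variable R : realType.
Local Notation C := R[i].
Local Notation fn := (R -> C).
Local Notation mu := (@lebesgue_measure R).
Local Notation Re := complex.Re.
Local Notation Im := complex.Im.
Implicit Types (f g h : fn) (z w : C).
Hint Resolve measurable_I0 : core.

Lemma ex_expn_lt (e : R) : 0 < e -> exists k : nat, (2 ^+ k)^-1 ^+ 2 < e.
Proof.
move=> e0; have [k _ /(_ k (leqnn k)) /= ke] := near_infty_natSinv_lt (PosNum e0).
exists k; apply: le_lt_trans ke.
have h : (k.+1%:R : R) <= 2 ^+ k by rewrite -natrX ler_nat ltn_expl.
have q0 : 0 < (2 ^+ k : R) by rewrite exprn_gt0.
apply: (@le_trans _ _ ((2 ^+ k)^-1)); last by rewrite lef_pV2 ?posrE// ltr0Sn.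
by rewrite expr2; apply: ler_piMr; rewrite ?invr_ge0 ?(ltW q0)// invf_le1// exprn_ege1 ?ler1n.
Qed.

Lemma cvg_geometric_increments (a : nat -> R) (K : R) :
  (forall k, `|a k.+1 - a k| <= K * (2 ^+ k)^-1) -> cvgn a.
Proof.
move=> aK.
have K0 : 0 <= K by have := aK 0%N; rewrite expr0 invr1 mulr1; exact: le_trans.
have ca : cvgn (series (telescope a)).
  apply: (@normed_cvg R R^o); apply: (@series_le_cvg _ _ (geometric K 2^-1)).
  - by move=> n; exact: normr_ge0.
  - by move=> n; rewrite /geometric /= mulr_ge0// exprn_ge0.
  - by move=> n; rewrite /geometric /= exprVn; exact: aK.
  - by apply: is_cvg_geometric_series; rewrite ger0_norm// invf_lt1// ltr1n.
rewrite (_ : a = (fun n => a 0%N + series (telescope a) n)).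
  by apply: is_cvgD => //; exact: is_cvg_cst.
by apply/funext => n; exact: eq_sum_telescope.
Qed.

(** The integrals add up to at most 2, so by monotone convergence the sum of the series is
    integrable, hence finite almost everywhere; it dominates each of its terms. *)
Lemma ae_fin_series (w : nat -> R -> R) :
  (forall k, measurable_fun (@I0 R) (w k)) ->
  (forall k x, 0 <= w k x) ->
  (forall k, (\int[mu]_(x in @I0 R) (w k x)%:E <= ((2 ^+ k)^-1)%:E)%E) ->
  {ae mu, forall x, I0 x -> exists K, forall k, w k x <= K}.
Proof.
move=> mw w0 wle.
have mwE k : measurable_fun (@I0 R) (fun x => (w k x)%:E) by apply/measurable_EFinP.
pose S x := (\sum_(k <oo) (w k x)%:E)%E.
have mS : measurable_fun (@I0 R) S.
  apply: (@ge0_emeasurable_sum _ _ _ _ (fun k x => (w k x)%:E) xpredT) => //.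
  by move=> k x _ _; rewrite lee_fin.
have S0 x : (0 <= S x)%E by apply: nneseries_ge0 => n _ _; rewrite lee_fin.
have iS : mu.-integrable (@I0 R) S.
  apply/integrableP; split => //.
  under eq_integral do rewrite gee0_abs//.
  apply: (@le_lt_trans _ _ 2%:E); last exact: ltry.
  rewrite /S integral_nneseries//.
  - apply: lime_le.
      by apply: is_cvg_nneseries => n _ _; apply: integral_ge0 => x _; rewrite lee_fin.
    apply: nearW => n.
    apply: (@le_trans _ _ (\sum_(0 <= k < n) ((2 ^+ k)^-1)%:E)%E).
      by apply: lee_sum => k _; exact: wle.
    rewrite sumEFin lee_fin.
    suff -> : \sum_(0 <= k < n) (2 ^+ k)^-1 = 2 - 2 * (2 ^+ n)^-1 :> R.
      by rewrite gerBl mulr_ge0// invr_ge0 exprn_ge0.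
    elim: n => [|n IH]; first by rewrite big_nil expr0; field.
    rewrite big_nat_recr//= IH exprS; field.
    by rewrite expf_neq0.
  - exact: measurable_I0.
  - by move=> n x _; rewrite lee_fin.
have aeS' : {ae mu, forall x, I0 x -> S x \is a fin_num} .
  by apply: integrable_ae iS; exact: measurable_I0.
apply: (aeS aeS') => x finS Ix.
exists (fine (S x)) => k; rewrite -lee_fin fineK ?finS//.
apply: le_trans (@nneseries_lim_ge _ _ xpredT 0%N k.+1 _); last first.
  by move=> n _ _; rewrite lee_fin.
rewrite big_nat_recr//= leeDr// sume_ge0// => n _.
by rewrite lee_fin.
Qed.

Lemma cvg_nsq (a : nat -> C) (b : C) :
  (fun k => Re (a k)) @ \oo --> Re b -> (fun k => Im (a k)) @ \oo --> Im b ->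
  forall c, (fun k => nsq (a k - c)) @ \oo --> nsq (b - c).
Proof.
move=> aR aI c; rewrite /nsq !ReImE; under eq_fun do rewrite !ReImE.
by apply: cvgD; apply: cvgM; apply: cvgB => //; exact: cvg_cst.
Qed.

Lemma limn_einf_le (w : nat -> \bar R) (c : \bar R) :
  (forall n, (w n <= c)%E) -> (limn_einf w <= c)%E.
Proof.
move=> wc; rewrite limn_einf_lim; apply: lime_le; first exact: is_cvg_einfs.
apply: nearW => n; apply: le_trans (wc n).
by apply: ereal_inf_lbound; exists n => /=.
Qed.

(** An upper limit is measurable whether or not the sequence converges, so it provides a measurable
    candidate for a limit that exists only almost everywhere. *)
Lemma lim_fine_esup (a : nat -> R) : cvgn a ->
  a @ \oo --> fine (limn_esup (EFin \o a)).
Proof.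
move=> ca.
have /cvg_limn_einf_sup[_ ->] : (EFin \o a) @ \oo --> (limn a)%:E.
  by apply: cvg_EFin; [exact: nearW|].
exact: ca.
Qed.

Definition L2_cauchy (u : nat -> fn) := forall eps : R, 0 < eps ->
  exists N, forall m n, (N <= m)%N -> (N <= n)%N -> l2norm (u m - u n) < eps.

Definition L2_cvg (u : nat -> fn) f := forall eps : R, 0 < eps ->
  exists N, forall n, (N <= n)%N -> l2norm (u n - f) < eps.

(** Riesz-Fischer: a rapidly Cauchy subsequence converges almost everywhere, and Fatou's lemma turns
    the pointwise limit into a limit in norm. *)
Lemma L2_complete (u : nat -> fn) : (forall n, L2 (u n)) -> L2_cauchy u ->
  exists f, L2 f /\ L2_cvg u f.
Proof.
move=> Lu Cu.
pose e k : R := (2 ^+ k)^-1 ^+ 2.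
have q0 k : 0 < (2 ^+ k : R) by rewrite exprn_gt0.
have e0 k : 0 < e k by rewrite /e exprn_gt0// invr_gt0.
have /choice[phi Hphi] : forall k, exists N, forall m n, (N <= m)%N -> (N <= n)%N ->
    l2norm (u m - u n) < e k by move=> k; exact: Cu.
(* Summing the thresholds gives an index beyond all of [phi 0], ..., [phi k] at once. *)
pose psi k := (\sum_(i < k.+1) phi i)%N.
have psi_ge k m : (k <= m)%N -> (phi k <= psi m)%N.
  move=> km; have km1 : (k < m.+1)%N by [].
  by rewrite /psi (bigD1 (Ordinal km1))//= leq_addr.
pose v k := u (psi k).
have vv k m n : (k <= m)%N -> (k <= n)%N -> sqn (v m - v n) <= e k ^+ 2.
  move=> km kn; rewrite -sqr_l2norm ler_pXn2r ?nnegrE ?l2norm_ge0 ?ltW//.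
  by apply: Hphi; exact: psi_ge.
(* Since [sqn (v k.+1 - v k)] is at most [16^-k], the weight [4^k] still leaves integrals below
   [2^-k]; boundedness of [w] at a point then forces increments of order [2^-k] there. *)
pose w k x : R := (2 ^+ k) ^+ 2 * nsq ((v k.+1 - v k) x).
have Lv k : L2 (v k) by exact: Lu.
have LB m n : L2 (v m - v n) by exact: L2B.
have good : {ae mu, forall x, I0 x -> exists K, forall k, w k x <= K}.
  apply: ae_fin_series.
  - move=> k; rewrite /w; apply: measurable_funM => //.
    exact: measurable_nsq (LB _ _).1.
  - by move=> k x; rewrite /w mulr_ge0 ?sqr_ge0 ?nsq_ge0.
  - move=> k; have iw := integrableZ_EFin ((2 ^+ k) ^+ 2) (LB k.+1 k).2.
    rewrite -(EFin_Rintegral iw) lee_fin RintegralZl//; last 2 first.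
      exact: measurable_I0.
      exact: (LB k.+1 k).2.
    rewrite -/(sqn _).
    apply: (@le_trans _ _ ((2 ^+ k) ^+ 2 * e k ^+ 2)).
      by rewrite ler_wpM2l ?sqr_ge0// vv.
    rewrite /e; set q := (2 ^+ k).
    have -> : q ^+ 2 * (q^-1 ^+ 2) ^+ 2 = q^-1 * q^-1.
      by field; exact: lt0r_neq0 (q0 k).
    by apply: ler_piMr; rewrite /q ?invr_ge0 ?(ltW (q0 k))// invf_le1// exprn_ege1 ?ler1n.
pose f : fn := fun x => Complex (fine (limn_esup (EFin \o (fun k => Re (v k x)))))
   (fine (limn_esup (EFin \o (fun k => Im (v k x))))).
have mf : cmeasurable f.
  split.
    apply: (measurableT_comp (@fine_measurable _ setT measurableT)).
    apply: (@measurable_fun_limn_esup _ _ _ _ (fun k x => (Re (v k x))%:E)) => k.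
    by apply/measurable_EFinP; exact: (Lv k).1.1.
  apply: (measurableT_comp (@fine_measurable _ setT measurableT)).
  apply: (@measurable_fun_limn_esup _ _ _ _ (fun k x => (Im (v k x))%:E)) => k.
  by apply/measurable_EFinP; exact: (Lv k).1.2.
have cf : {ae mu, forall x, I0 x -> ((fun k => Re (v k x)) @ \oo --> Re (f x)) /\
                              ((fun k => Im (v k x)) @ \oo --> Im (f x))}.
  apply: (aeS good) => x gx Ix; have [K wK] := gx Ix.
  have nK k : nsq (v k.+1 x - v k x) <= (Num.sqrt `|K| * (2 ^+ k)^-1) ^+ 2.
    rewrite exprMn sqr_sqrtr// exprVn -ler_pdivrMr ?invr_gt0 ?exprn_gt0//.
    by rewrite invrK mulrC (le_trans (wK k))// ler_norm.
  have sq0 k : 0 <= Num.sqrt `|K| * (2 ^+ k)^-1.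
    by rewrite mulr_ge0 ?sqrtr_ge0// invr_ge0 ltW.
  split; apply: lim_fine_esup; apply: (@cvg_geometric_increments _ (Num.sqrt `|K|)) => k.
    rewrite -(@ler_pXn2r _ 2) ?nnegrE ?sq0 ?normr_ge0// real_normK ?num_real//; apply: le_trans (nK k).
    by rewrite /nsq !ReImE lerDl sqr_ge0.
  rewrite -(@ler_pXn2r _ 2) ?nnegrE ?sq0 ?normr_ge0// real_normK ?num_real//; apply: le_trans (nK k).
  by rewrite /nsq !ReImE lerDr sqr_ge0.
have mfB k : cmeasurable (f - v k).
  by apply: cmeasurableD => //; exact: (L2N (Lv k)).1.
(* Fatou along [v (m + k)] as [m] grows, with [k] fixed. *)
have fle k : (\int[mu]_(x in @I0 R) (nsq ((f - v k) x))%:E <= (e k ^+ 2)%:E)%E.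
  pose W m x := (nsq (v (m + k)%N x - v k x))%:E.
  have mW m : measurable_fun (@I0 R) (W m).
    by apply/measurable_EFinP; exact: measurable_nsq (LB (m + k)%N k).1.
  have W0 m x : I0 x -> (0 <= W m x)%E by rewrite lee_fin nsq_ge0.
  have : (\int[mu]_(x in @I0 R) limn_einf (W^~ x) <=
      limn_einf (fun m => \int[mu]_(x in @I0 R) W m x))%E.
    by apply: fatou => //; exact: measurable_I0.
  rewrite (@ae_eq_integral _ _ _ mu _ (fun x => limn_einf (W^~ x)) (fun x => (nsq ((f - v k) x))%:E))//.
  - move=> /le_trans; apply; apply: limn_einf_le => m.
    rewrite -(EFin_sqn (LB (m + k)%N k)).
    by rewrite lee_fin; apply: vv => //; exact: leq_addl.
  - exact: measurable_I0.
  - by apply/measurable_EFinP; exact: measurable_nsq.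
  - rewrite /limn_einf; apply: measurableT_comp => //.
    apply: (@measurable_fun_limn_esup _ _ _ _ (fun m x => - W m x)%E) => m.
    exact: measurableT_comp.
  - apply: (aeS cf) => x cx Ix; have [cR cI] := cx Ix.
    have : (fun m => W m x) @ \oo --> (nsq (f x - v k x))%:E.
      apply: cvg_EFin; first exact: nearW.
      have := @cvg_nsq (fun m => v m x) (f x) cR cI (v k x).
      by rewrite -(cvg_shiftn k).
    by move=> /cvg_limn_einf_sup[].
have Lf_ k : L2 (f - v k).
  split => //; apply/integrableP; split.
    by apply/measurable_EFinP; exact: measurable_nsq.
  under eq_integral do rewrite gee0_abs ?lee_fin ?nsq_ge0//.
  by rewrite (le_lt_trans (fle k))// ltry.
have Lf : L2 f by rewrite -(subrK (v 0%N) f); exact: L2D.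
have nf k : l2norm (f - v k) <= e k.
  rewrite -(@ler_pXn2r _ 2) ?nnegrE ?l2norm_ge0 ?(ltW (e0 k))//.
  rewrite sqr_l2norm -lee_fin EFin_sqn//.
exists f; split => // eps eps0.
have [k ke] := @ex_expn_lt (eps / 2) (divr_gt0 eps0 (ltr0Sn _ _)).
exists (psi k) => n kn.
have -> : u n - f = (u n - v k) - (f - v k) by ring.
apply: le_lt_trans (l2normB _ _) _ => //; first exact: L2B.
have : l2norm (u n - v k) < e k.
  by apply: Hphi; [apply: leq_trans kn; exact: psi_ge|exact: psi_ge].
by have := nf k; rewrite /e in ke *; lra.
Qed.
End L2_complete.

(** * Orthonormality of the exponentials *)

Section exponentials.
Variable R : realType.
Local Notation C := R[i].
Local Notation fn := (R -> C).
Local Notation mu := (@lebesgue_measure R).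
Local Notation e := (@Defs.expn R).
Implicit Types (f g h p : fn) (z w c : C) (m n : int).

Lemma cexpD m n : e (m + n) = e m * e n.
Proof.
apply/funext => x; rewrite -[RHS]/(e m x * e n x) /Defs.expn intrD mulrDr mulrDl cosD sinD.
by apply: complexP; rewrite !ReImE //= addrC.
Qed.

Lemma conjf_expn n : conjf (e n) = e (- n).
Proof.
apply/funext => x; rewrite /conjf /Defs.expn mulrNz mulrN mulNr cosN sinN.
by apply: complexP; rewrite !ReImE.
Qed.

Lemma cexp0 : e 0 = 1.
Proof.
apply/funext => x; rewrite /Defs.expn mulr0 mul0r cos0 sin0.
exact: complexP.
Qed.

Lemma nsq_expn n x : nsq (e n x) = 1.
Proof. by rewrite /nsq /= cos2Dsin2. Qed.

Lemma cmeasurable_expn n : cmeasurable (e n).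
Proof.
split; apply: measurable_funTS; apply: continuous_measurable_fun => x /=.
  apply: (@continuous_comp _ _ _ (fun x => 2 * pi * n%:~R * x) cos).
    by apply: cvgM; [exact: cvg_cst|exact: cvg_id].
  exact: continuous_cos.
apply: (@continuous_comp _ _ _ (fun x => 2 * pi * n%:~R * x) sin).
  by apply: cvgM; [exact: cvg_cst|exact: cvg_id].
exact: continuous_sin.
Qed.

Lemma Linf_expn n : Linf (e n).
Proof.
split; first exact: cmeasurable_expn.
by exists 1; apply: aeW => x _; rewrite nsq_expn.
Qed.

Lemma L2_expn n : L2 (e n).
Proof.
split; first exact: cmeasurable_expn.
apply: (@measurable_bounded_integrable _ _ _ mu (fun x => nsq (e n x)) (@I0 R)).
- exact: measurable_I0.
- suff : (mu (@I0 R) < +oo)%E by [].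
  by rewrite mu_I0 ltry.
- exact: measurable_nsq (cmeasurable_expn n).
- by exists 1; split => // t t1 x _ /=; rewrite nsq_expn normr1 ltW.
Qed.

Lemma Rintegral_derivative (F k : R -> R) : continuous k ->
  (forall x : R, is_derive x (1 : R) F (k x)) -> Rintegral mu (@I0 R) k = F (1 / 2) - F (- (1 / 2)).
Proof.
move=> ck dF.
have cF : continuous F.
  move=> x; apply: differentiable_continuous; apply/derivable1_diffP.
  by have [] := dF x.
rewrite /Rintegral (@continuous_FTC2 R k F)//.
- lra.
- exact: continuous_subspaceT.
- split.
  + by move=> x _; have [] := dF x.
  + by apply: cvg_at_right_filter; exact: cF.
  + by apply: cvg_at_left_filter; exact: cF.
- by move=> x _; rewrite derive1E; have [_ ->] := dF x.
Qed.

Lemma sin_pi_int n : sin (pi * n%:~R) = 0 :> R.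
Proof.
have sin_nat (k : nat) : sin (pi * k%:R) = 0 :> R.
  elim: k => [|k IH]; first by rewrite mulr0 sin0.
  by rewrite mulrS mulrDr mulr1 addrC sinDpi IH oppr0.
case: n => k; first exact: sin_nat.
by rewrite NegzE mulrNz mulrN sinN sin_nat oppr0.
Qed.

Lemma cint_expn n : n != 0 -> cint (e n) = 0.
Proof.
move=> n0; pose a : R := 2 * pi * n%:~R.
have a0 : a != 0.
  rewrite /a mulf_neq0//; last by rewrite intr_eq0.
  by rewrite mulf_neq0// gt_eqF// pi_gt0.
have dM x : is_derive x (1 : R) ( *%R a) a.
  by apply: is_derive_eq; rewrite -[LHS]/(a * 1) mulr1.
have ca : continuous ( *%R a) by move=> x; apply: cvgM; [exact: cvg_cst|exact: cvg_id].
(* At the endpoints the argument is plus or minus [pi * n]: the sine vanishes and the two cosines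
   agree, so both antiderivatives below have zero increment. *)
have h1 : a * (1 / 2) = pi * n%:~R by rewrite /a; field.
have h2 : a * (- (1 / 2)) = - (pi * n%:~R) by rewrite mulrN h1.
have dS x : is_derive x (1 : R) (fun x => a^-1 * sin (a * x)) (cos (a * x)).
  have dZ := is_deriveZ a^-1 (is_derive1_comp (is_derive_sin (a * x)) (dM x)).
  apply: is_derive_eq dZ _.
  by rewrite -[LHS]/(a^-1 * (cos (a * x) * a)); field.
have dC x : is_derive x (1 : R) (fun x => - a^-1 * cos (a * x)) (sin (a * x)).
  have dZ := is_deriveZ (- a^-1) (is_derive1_comp (is_derive_cos (a * x)) (dM x)).
  apply: is_derive_eq dZ _.
  by rewrite -[LHS]/(- a^-1 * (- sin (a * x) * a)); field.
have cc : continuous (fun x => cos (a * x)).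
  by move=> x; apply: continuous_comp; [exact: ca|exact: continuous_cos].
have cs : continuous (fun x => sin (a * x)).
  by move=> x; apply: continuous_comp; [exact: ca|exact: continuous_sin].
apply: complexP => /=.
  by rewrite (Rintegral_derivative cc dS) h1 h2 sinN sin_pi_int; lra.
by rewrite (Rintegral_derivative cs dC) h1 h2 cosN; lra.
Qed.

Lemma inner_expn m n : inner (e m) (e n) = (m == n)%:R.
Proof.
rewrite innerE conjf_expn -cexpD; have [->|mn] := eqVneq m n.
  rewrite subrr cexp0; apply: complexP => /=.
    by rewrite Rintegral_cst ?mul1r; [exact: (congr1 fine (mu_I0 R))|exact: measurable_I0].
  by rewrite Rintegral_cst ?mul0r//; exact: measurable_I0.
by rewrite cint_expn// subr_eq0.
Qed.

End exponentials.

(** * Completeness of the exponentials *)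

Section peak.
Variable R : realType.
Implicit Types (x y : R) (n N : nat).

Lemma bernoulli_ineq y N : -1 <= y -> 1 + N%:R * y <= (1 + y) ^+ N.
Proof.
move=> y1; elim: N => [|N IH]; first by rewrite mul0r addr0 expr0.
rewrite exprS -natr1; apply: (@le_trans _ _ ((1 + y) * (1 + N%:R * y))).
  have : 0 <= N%:R * (y * y) by rewrite mulr_ge0// -expr2 sqr_ge0.
  by nra.
by apply: ler_wpM2l => //; lra.
Qed.

(** The peaking polynomials of Brosowski and Deutsch's proof of the Stone-Weierstrass theorem: on
    [[0, 1]] they separate the points below 1/2 from those above. *)
Definition peak x n := (1 - x ^+ n) ^+ (2 ^ n).

Lemma peak_ge0 x n : 0 <= x <= 1 -> 0 <= peak x n.
Proof.
by move=> /andP[x0 x1]; rewrite exprn_ge0// subr_ge0 exprn_ile1.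
Qed.

Lemma peak_le1 x n : 0 <= x <= 1 -> peak x n <= 1.
Proof.
move=> /andP[x0 x1]; rewrite exprn_ile1 ?subr_ge0 ?exprn_ile1//.
by rewrite gerBl exprn_ge0.
Qed.

(** Bernoulli's inequality squeezes the peak between [1 - (2 x)^n] and 1. *)
Lemma peak_cvg1 x : 0 <= x -> x < 1 / 2 -> peak x n @[n --> \oo] --> (1 : R).
Proof.
move=> x0 x2.
have c1 : (fun n => 1 - (2 * x) ^+ n) @ \oo --> (1 : R).
  rewrite -[X in _ --> X]subr0; apply: cvgB; first exact: cvg_cst.
  by apply: cvg_expr; rewrite ger0_norm; lra.
have cc : (fun n : nat => 1) @ \oo --> (1 : R) by exact: cvg_cst.
apply: squeeze_cvgr c1 cc; apply: nearW => n.
rewrite peak_le1 ?andbT; last by rewrite x0; lra.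
have := @bernoulli_ineq (- x ^+ n) (2 ^ n); rewrite /peak.
have : x ^+ n <= 1 by rewrite exprn_ile1//; lra.
rewrite natrX exprMn mulrN => ? H; apply: H.
by rewrite lerN2.
Qed.

(** Bernoulli bounds [(1 + x^n)^(2^n)] below by [(2 x)^n], and its product with the peak is at most
    1; so the peak is at most [(2 x)^-n]. *)
Lemma peak_cvg0 x : 1 / 2 < x -> x <= 1 -> peak x n @[n --> \oo] --> (0 : R).
Proof.
move=> x2 x1.
have x0 : 0 < x by lra.
have c1 : (fun n => (2 * x)^-1 ^+ n) @ \oo --> (0 : R).
  apply: cvg_expr; rewrite ger0_norm ?invr_ge0; last lra.
  by rewrite invf_lt1; lra.
have cc : (fun n : nat => 0) @ \oo --> (0 : R) by exact: cvg_cst.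
apply: squeeze_cvgr cc c1; apply: nearW => n.
have xn1 : x ^+ n <= 1 by rewrite exprn_ile1//; lra.
have xn0 : 0 < x ^+ n by rewrite exprn_gt0.
have b0 : 0 <= peak x n by rewrite peak_ge0//; lra.
rewrite b0 /= exprVn -[leRHS]mul1r ler_pdivlMr; last by rewrite exprn_gt0; lra.
have := @bernoulli_ineq (x ^+ n) (2 ^ n).
rewrite natrX -exprMn => /(_ _) H.
have {}H : (2 * x) ^+ n <= (1 + x ^+ n) ^+ (2 ^ n).
  by apply: le_trans (H _); lra.
apply: le_trans (ler_wpM2l b0 H) _.
rewrite /peak -exprMn exprn_ile1//; nra.
Qed.

Lemma cos_gt x r : 0 < r <= 1 / 2 -> `|x| < r -> cos (2 * pi * r) < cos (2 * pi * x).
Proof.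
move=> /andP[r0 r2] xr; have pi0 := @pi_gt0 R.
rewrite -(cos_norm (_ * x)) normrM [`|2 * pi|]ger0_norm; last by lra.
have a0 := normr_ge0 x.
by rewrite ltr_cos ?in_itv/= ?ltr_pM2l//; nra.
Qed.

Lemma cos_lt x r : 0 < r <= 1 / 2 -> r < `|x| < 1 - r ->
  cos (2 * pi * x) < cos (2 * pi * r).
Proof.
move=> /andP[r0 r2] /andP[rx xr]; have pi0 := @pi_gt0 R.
rewrite -(cos_norm (_ * x)) normrM [`|2 * pi|]ger0_norm; last by lra.
have a0 := normr_ge0 x.
have [x2|x2] := leP `|x| (1 / 2).
  by rewrite ltr_cos ?in_itv/= ?ltr_pM2l//; nra.
(* Beyond the half period, reflect to [1 - |x|], which again lies between [r] and 1/2. *)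
have -> : cos (2 * pi * `|x|) = cos (2 * pi * (1 - `|x|)).
  rewrite -[RHS]cosN -[RHS]cosD2pi; congr cos; rewrite mulr2n; ring.
by rewrite ltr_cos ?in_itv/= ?ltr_pM2l//; nra.
Qed.

End peak.

(** * Vanishing of a function from its integrals over balls *)

Section balls.
Variable R : realType.
Local Notation mu := (@lebesgue_measure R).

Lemma ae_neq (a : R) : {ae mu, forall x, x != a}.
Proof.
exists [set a]; split => //; first exact: lebesgue_measure_set1.
by move=> x /= /negP; rewrite negbK => /eqP.
Qed.

(** At an interior Lebesgue point the averages over shrinking centred balls tend to the value of
    [h], yet they are eventually 0. The two endpoints form a null set. *)
Lemma ae_zero_of_balls (h : R -> R) : mu.-integrable (@I0 R) (EFin \o h) ->
  (forall x r : R, 0 < r -> `|x| + r < 1 / 2 ->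
     (\int[mu]_(y in @I0 R) (h y * \1_(ball x r) y)%:E = 0)%E) ->
  {ae mu, forall x, I0 x -> h x = 0}.
Proof.
(* Extension by zero, since the differentiation theorem is applied on the whole line. *)
move=> ih Hb; pose k := h \_ (@I0 R).
have lk : locally_integrable setT k.
  by apply: integrable_locally_restrict => //; exact: measurable_I0.
have rad0 (n : nat) : 0 < (n.+1%:R^-1 : R) by rewrite invr_gt0 ltr0n.
pose rad (n : nat) : {posnum R} := PosNum (rad0 n).
pose E (x : R) n := ball x (rad n)%:num.
have hE x : nicely_shrinking x (E x).
  split; first by move=> n; exact: measurable_ball.
  exists (1, rad); split.
  - exact: ltr01.
  - exact: cvg_harmonic.
  - by move=> n x0.
  - by move=> n; rewrite /= mul1e.
have ae1 := lebesgue_differentiation lk.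
apply: (aeS (ae_and ae1 (ae_and (ae_neq (1 / 2)) (ae_neq (- (1 / 2)))))).
move=> x [px [/negP x1 /negP x2]] Ix.
have xlt : `|x| < 1 / 2.
  move: Ix; rewrite /I0 /= in_itv /= => /andP[a b]; rewrite ltr_norml.
  by rewrite !lt_neqAle a b !andbT; apply/andP; split; apply/negP => /eqP H;
    [apply: x2|apply: x1]; apply/eqP.
have c := nice_lebesgue_differentiation hE lk px.
have d0 : 0 < 1 / 2 - `|x| by rewrite subr_gt0.
have c0 : ((mu (E x n))^-1 * \int[mu]_(y in E x n) (k y)%:E)%E @[n --> \oo] --> 0%E.
  apply: cvg_near_cst.
  have := near_infty_natSinv_lt (PosNum d0); apply: filterS => n /= nd.
  rewrite (_ : (\int[mu]_(y in E x n) (k y)%:E)%E = 0%E) ?mule0//.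
  rewrite -(Hb x n.+1%:R^-1) => //; last by rewrite -ltrBrDl.
  rewrite integral_mkcond [RHS]integral_mkcond; apply: eq_integral => y _.
  rewrite !patchE /E /= indicE /k patchE.
  by case: ifPn; case: ifPn => //=; rewrite ?mulr1 ?mulr0.
have : (k x)%:E = 0%E by apply: (cvg_unique _ c c0); exact: ereal_hausdorff.
by rewrite /k patchE mem_set// => -[].
Qed.
End balls.

(** * Trigonometric polynomials and their peaks *)

Section trigonometric_completeness.
Variable R : realType.
Local Notation C := R[i].
Local Notation fn := (R -> C).
Local Notation mu := (@lebesgue_measure R).
Local Notation Re := complex.Re.
Local Notation Im := complex.Im.
Local Notation e := (@Defs.expn R).
Implicit Types (f g h p q : fn) (z w c : C) (m n : int).

(** A trigonometric polynomial of degree one in [y]. The division by 4 keeps its values in [[0, 1]],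
    and the offset puts the crossing of the level 1/2 at distance [r] from [a]. *)
Definition hat (a r y : R) : R := 1 / 2 - (cos (2 * pi * (y - a)) - cos (2 * pi * r)) / 4.

Lemma hat_itv a r y : 0 <= hat a r y <= 1.
Proof.
have := cos_le1 (2 * pi * (y - a)); have := cos_geN1 (2 * pi * (y - a)).
have := cos_le1 (2 * pi * r); have := cos_geN1 (2 * pi * r).
by rewrite /hat => *; apply/andP; split; lra.
Qed.

Lemma measurable_peak_hat a r (n : nat) : measurable_fun (@I0 R) (fun y => peak (hat a r y) n).
Proof.
rewrite /peak /hat.
apply: measurable_funX; apply: measurable_funB => //; apply: measurable_funX.
apply: measurable_funB => //; apply: measurable_funM => //; apply: measurable_funB => //.
apply: measurable_funTS; apply: continuous_measurable_fun => x /=.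
apply: (@continuous_comp _ _ _ (fun y => 2 * pi * (y - a)) cos).
  apply: cvgM; first exact: cvg_cst.
  by apply: cvgB; [exact: cvg_id|exact: cvg_cst].
exact: continuous_cos.
Qed.

(* [hat a r < 1/2] exactly on the ball (up to its boundary), so the peaks tend
   boundedly to its indicator function. *)
Lemma ae_zero_of_peaks (h : R -> R) : mu.-integrable (@I0 R) (EFin \o h) ->
  (forall a r (n : nat), Rintegral mu (@I0 R) (fun y => h y * peak (hat a r y) n) = 0) ->
  {ae mu, forall x, I0 x -> h x = 0}.
Proof.
move=> ih Hb; apply: ae_zero_of_balls => // a r r0 ar.
have mh : measurable_fun (@I0 R) h.
  by apply/measurable_EFinP; exact: measurable_int ih.
have mb (n : nat) : measurable_fun (@I0 R) (fun y => h y * peak (hat a r y) n).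
  by apply: measurable_funM => //; exact: measurable_peak_hat.
have bn (n : nat) y : `|h y * peak (hat a r y) n| <= `|h y|.
  rewrite normrM ler_piMr// ger0_norm ?peak_ge0 ?peak_le1 ?hat_itv//.
have ian : mu.-integrable (@I0 R) (EFin \o (fun y => `|h y|)).
  by apply: integrable_norm.
have [] := @dominated_convergence _ _ _ mu (@I0 R) _
  (fun (n : nat) y => (h y * peak (hat a r y) n)%:E)
  (fun y => (h y * \1_(ball a r) y)%:E) (EFin \o (fun y => `|h y|)).
- exact: measurable_I0.
- by move=> n; apply/measurable_EFinP; exact: mb.
- apply/measurable_EFinP; apply: measurable_funM => //.
  by apply: measurable_indic; exact: measurable_ball.
- apply: (aeS (ae_and (ae_neq (a + r)) (ae_neq (a - r)))) => y [/negP y1 /negP y2] Iy.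
  apply: cvg_EFin; first exact: nearW.
  apply: cvgM; first exact: cvg_cst.
  have r2 : 0 < r <= 1 / 2 by rewrite r0/=; have := normr_ge0 a; lra.
  have /andP[h0 h1] := hat_itv a r y.
  rewrite indicE; have [ya|ya] := pselect (ball a r y).
    rewrite mem_set//; apply: peak_cvg1 => //; rewrite /hat.
    have : `|y - a| < r by move: ya; rewrite /ball /= distrC.
    by move=> /(cos_gt r2); lra.
  rewrite memNset//; apply: peak_cvg0 => //; rewrite /hat.
  (* The upper bound keeps [y] off the translates of the ball by the period; it follows from
     [|y| <= 1/2] and [|a| + r < 1/2]. *)
  have : r < `|y - a| < 1 - r.
    have ya' : r <= `|y - a|.
      rewrite leNgt; apply/negP => H; apply: ya.
      by rewrite /ball /= distrC.
    apply/andP; split.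
      rewrite lt_neqAle ya' andbT; apply/negP => /eqP.
      have [ya0|ya0] := leP 0 (y - a).
        by rewrite ger0_norm// => H; apply: y1; apply/eqP; lra.
      by rewrite ltr0_norm// => H; apply: y2; apply/eqP; lra.
    have yI : `|y| <= 1 / 2 by rewrite ler_norml; move: Iy; rewrite /I0 /= in_itv.
    by have := ler_normB y a; lra.
  by move=> /(cos_lt r2); lra.
- exact: ian.
- by apply: aeW => y n _; rewrite /= lee_fin.
move=> _ _ c.
apply/esym; apply: (cvg_unique _ _ c); first exact: ereal_hausdorff.
apply: cvg_near_cst; apply: nearW => n /=.
rewrite -EFin_Rintegral ?Hb//.
exact: le_integrable_EFin ian (bn n).
Qed.

(** Built one monomial at a time, so that closure under sums and products and orthogonality
    statements are proved by induction, with no bookkeeping of frequencies. *)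
Inductive trigp : fn -> Prop :=
| trigp0 : trigp 0
| trigp_cons c n p : trigp p -> trigp (cst c * e n + p).

Lemma trigpD p q : trigp p -> trigp q -> trigp (p + q).
Proof.
move=> tp tq; elim: tp => [|c n p' _ IH]; first by rewrite add0r.
by rewrite -addrA; exact: trigp_cons.
Qed.

Lemma trigp_mono c n : trigp (cst c * e n).
Proof. by rewrite -[_ * _]addr0; apply: trigp_cons; exact: trigp0. Qed.

Lemma trigp_cst c : trigp (cst c).
Proof. by have := trigp_mono c 0; rewrite cexp0 mulr1. Qed.

Lemma trigpM p q : trigp p -> trigp q -> trigp (p * q).
Proof.
move=> tp tq; elim: tp => [|c n p' _ IH]; first by rewrite mul0r; exact: trigp0.
rewrite mulrDl; apply: trigpD => //.
elim: tq => [|d k q' _ IHq]; first by rewrite mulr0; exact: trigp0.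
rewrite mulrDr; apply: trigpD => //.
have -> : cst c * e n * (cst d * e k) = cst (c * d) * e (n + k).
  by rewrite cexpD -[cst (c * d)]/(cst c * cst d); ring.
exact: trigp_mono.
Qed.

Lemma trigpZ c p : trigp p -> trigp (cst c * p).
Proof. by apply: trigpM; exact: trigp_cst. Qed.

Lemma trigpX p (k : nat) : trigp p -> trigp (p ^+ k).
Proof.
move=> tp; elim: k => [|k IH]; first exact: (trigp_cst 1).
by rewrite exprS; exact: trigpM.
Qed.

Lemma trigp_L2 p : trigp p -> L2 p.
Proof.
elim=> [|c n q _ IH]; first exact: L20.
by apply: L2D => //; apply: L2Z; exact: L2_expn.
Qed.

Lemma inner_trigp f p : L2 f -> (forall n, inner f (e n) = 0) -> trigp p -> inner f p = 0.
Proof.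
move=> Lf f0; elim=> [|c n q tq IH].
  by rewrite inner_conj// ?inner0l ?conjC0//; exact: L20.
have Le := L2_expn R n; have Lq := trigp_L2 tq.
by rewrite innerDr ?IH ?innerZr ?f0 ?mulr0 ?addr0//; exact: L2Z.
Qed.

Lemma exprfE p (k : nat) x : (p ^+ k) x = p x ^+ k.
Proof. by elim: k => // k IH; rewrite !exprS -IH. Qed.

Lemma trigp_hat a r : trigp (fun y => (hat a r y)%:C%C).
Proof.
have -> : (fun y => (hat a r y)%:C%C) =
  (* The cosine of [2 pi (y - a)] is half the sum of [conj (e_1 a) e_1 y] and its conjugate; the
     factor 1/4 in [hat] makes the coefficients 1/8. *)
  cst (1 / 2 + cos (2 * pi * r) / 4)%:C%C + (cst (- (1 / 8)%:C%C * (e 1 a)^*) * e 1 +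
  cst (- (1 / 8)%:C%C * (e (-1) a)^*) * e (-1)).
  apply/funext => y.
  rewrite -[RHS]/((1 / 2 + cos (2 * pi * r) / 4)%:C%C +
    (- (1 / 8)%:C%C * (e 1 a)^* * e 1 y +
    - (1 / 8)%:C%C * (e (-1) a)^* * e (-1) y)).
  have eN x : e (-1) x = (e 1 x)^* by rewrite -[RHS]/(conjf (e 1) x) conjf_expn.
  rewrite !eN conjCK /Defs.expn /hat mulr1z mulr1 mulrBr cosB.
  by apply: complexP; rewrite !ReImE /=; field.
by apply: trigpD; [exact: trigp_cst|apply: trigpD; exact: trigp_mono].
Qed.

Lemma trigp_peak a r (k : nat) : trigp (fun y => (peak (hat a r y) k)%:C%C).
Proof.
have -> : (fun y => (peak (hat a r y) k)%:C%C) =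
    (1 + cst (-1) * (fun y => (hat a r y)%:C%C) ^+ k) ^+ (2 ^ k).
  apply/funext => y; rewrite exprfE.
  rewrite -[X in X ^+ _]/(1 + -1 * (((fun y => (hat a r y)%:C%C) : fn) ^+ k) y) exprfE.
  by rewrite /peak rmorphXn rmorphB rmorph1 rmorphXn mulN1r.
apply: trigpX; apply: trigpD; first exact: (trigp_cst 1).
by apply: trigpZ; apply: trigpX; exact: trigp_hat.
Qed.

(** The peaks are real-valued, so the real and imaginary parts of [f] are separately orthogonal to
    them. *)
Lemma exponentials_complete f : L2 f -> (forall n, fcoef f n = 0) -> ae_zero f.
Proof.
move=> Lf f0.
have Hb a r k := inner_trigp Lf f0 (trigp_peak a r k).
have [iR iI] : cintegrable f.
  by have := L2M_cintegrable Lf (L2_expn R 0); rewrite cexp0 mulr1.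
have hR : {ae mu, forall x, I0 x -> Re (f x) = 0}.
  apply: ae_zero_of_peaks => // a r k; have := congr1 (@complex.Re R) (Hb a r k).
  move=> /= H; rewrite -[RHS]H; congr (Rintegral _ _ _); apply/funext => y.
  by rewrite !ReImE /= oppr0 mulr0 subr0.
have hI : {ae mu, forall x, I0 x -> Im (f x) = 0}.
  apply: ae_zero_of_peaks => // a r k; have := congr1 (@complex.Im R) (Hb a r k).
  move=> /= H; rewrite -[RHS]H; congr (Rintegral _ _ _); apply/funext => y.
  by rewrite !ReImE /= oppr0 mulr0 add0r.
apply: (aeS (ae_and hR hI)) => x [xR xI] Ix.
by apply: complexP; rewrite ?xR ?xI.
Qed.

End trigonometric_completeness.

(** * Orthogonal projections and Parseval *)

Section hilbert.
Variable R : realType.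
Local Notation C := R[i].
Local Notation fn := (R -> C).
Local Notation Re := complex.Re.
Local Notation e := (@Defs.expn R).
Implicit Types (f g h p q : fn) (z c : C) (m n : int) (F : seq int).

(** * Limits in norm *)

Lemma small_eq0 (a : R) : 0 <= a -> (forall eps : R, 0 < eps -> a <= eps) -> a = 0.
Proof.
move=> a0 ale; apply/eqP; rewrite eq_le a0 andbT leNgt; apply/negP => a1.
by have := ale (a / 2) (divr_gt0 a1 (ltr0Sn _ _)); lra.
Qed.

Lemma sqn_lt f (eps : R) : 0 < eps -> l2norm f < Num.sqrt eps -> sqn f < eps.
Proof.
by move=> e0 fe; rewrite -sqr_l2norm -[ltRHS](sqr_sqrtr (ltW e0))
  ltr_pXn2r ?nnegrE ?l2norm_ge0 ?sqrtr_ge0.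
Qed.

Lemma l2norm_lt f (eps : R) : 0 < eps -> sqn f < eps ^+ 2 -> l2norm f < eps.
Proof.
by move=> e0 fe; rewrite -(@ltr_pXn2r _ 2) ?nnegrE ?l2norm_ge0 ?(ltW e0)// sqr_l2norm.
Qed.

Lemma l2norm_le_sqn f h (K : R) : 0 <= K ->
  (l2norm f <= K * l2norm h) = (sqn f <= K ^+ 2 * sqn h).
Proof.
move=> K0; rewrite -(@ler_pXn2r _ 2) ?nnegrE ?mulr_ge0 ?l2norm_ge0//.
by rewrite exprMn !sqr_l2norm.
Qed.

Lemma L2_cvg_sqn (u : nat -> fn) f : L2_cvg u f -> forall eps : R, 0 < eps ->
  exists N : nat, forall k, (N <= k)%N -> sqn (u k - f) < eps.
Proof.
move=> uf eps e0; have [|N HN] := uf (Num.sqrt eps); first by rewrite sqrtr_gt0.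
by exists N => k /HN; exact: sqn_lt.
Qed.

Lemma L2_cvg_cauchy (u : nat -> fn) f : (forall k, L2 (u k)) -> L2 f ->
  L2_cvg u f -> L2_cauchy u.
Proof.
move=> Lu Lf uf eps e0; have [N HN] := uf _ (divr_gt0 e0 (ltr0Sn _ 1)).
exists N => i j Ni Nj; have -> : u i - u j = (u i - f) - (u j - f) by ring.
apply: le_lt_trans (l2normB _ _) _; try exact: L2B.
by have := HN i Ni; have := HN j Nj; lra.
Qed.

Lemma L2_cvg_mul g (u : nat -> fn) f : Linf g -> (forall k, L2 (u k)) -> L2 f ->
  L2_cvg u f -> L2_cvg (fun k => g * u k) (g * f).
Proof.
move=> /Linf_mul[M [M0 gM]] Lu Lf uf eps e0.
have M1 : 0 < M + 1 by lra.
have [N HN] := uf _ (divr_gt0 e0 M1); exists N => i /HN.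
rewrite ltr_pdivlMr// => H; rewrite -mulrBr.
have [_] := gM _ (L2B (Lu i) Lf); have := l2norm_ge0 (u i - f); nra.
Qed.

Lemma L2_cvgB (u v : nat -> fn) f h : (forall k, L2 (u k)) -> (forall k, L2 (v k)) ->
  L2 f -> L2 h -> L2_cvg u f -> L2_cvg v h -> L2_cvg (fun k => u k - v k) (f - h).
Proof.
move=> Lu Lv Lf Lh uf vh eps e0.
have [N HN] := uf _ (divr_gt0 e0 (ltr0Sn _ 1)).
have [M HM] := vh _ (divr_gt0 e0 (ltr0Sn _ 1)).
exists (maxn N M) => i; rewrite geq_max => /andP[/HN Hi /HM Hj].
have -> : u i - v i - (f - h) = (u i - f) - (v i - h) by ring.
apply: le_lt_trans (l2normB _ _) _; try exact: L2B.
by lra.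
Qed.

Lemma inner_lim0 (u : nat -> fn) f h : (forall k, L2 (u k)) -> L2 f -> L2 h ->
  L2_cvg u f -> (forall k, inner (u k) h = 0) -> inner f h = 0.
Proof.
move=> Lu Lf Lh uf u0; apply: nsq_eq0; apply: small_eq0; first exact: nsq_ge0.
move=> eps e0; have h0 : 0 < sqn h + 1 by have := sqn_ge0 h; lra.
have [N /(_ N (leqnn N))] := L2_cvg_sqn uf (divr_gt0 e0 h0).
rewrite ltr_pdivlMr// => H.
have := cauchy_schwarz (L2B (Lu N) Lf) Lh.
rewrite innerBl// u0 sub0r {1}/nsq !ReImE !sqrrN -/(nsq _) => /le_trans; apply.
by have := sqn_ge0 (u N - f); lra.
Qed.

(** * Nearest points in subspaces *)

Lemma sqn_parallelogram f g : L2 f -> L2 g ->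
  sqn (f + g) + sqn (f - g) = 2 * sqn f + 2 * sqn g.
Proof. by move=> Lf Lg; rewrite sqnD// sqnB//; ring. Qed.

(** The projection [p] lies in the closure of [V], which the sequence [v] records. It is applied
    with [V] the trigonometric polynomials, [H2], and the range of a Toeplitz operator. *)
Lemma subspace_projection (V : fn -> Prop) f :
  (forall v, V v -> L2 v) -> V 0 -> (forall v w : fn, V v -> V w -> V (v + w)) ->
  (forall c v, V v -> V (cst c * v)) -> L2 f ->
  exists (v : nat -> fn) p, [/\ forall k, V (v k), L2 p, L2_cvg v p &
    forall w : fn, V w -> inner (f - p) w = 0].
Proof.
move=> VL V0 VD VZ Lf.
pose D : set R := [set sqn (f - v) | v in V].
have iD : has_inf D.
  split; first by exists (sqn (f - 0)); exists 0.
  by exists 0 => _ [v _ <-]; exact: sqn_ge0.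
pose d := inf D.
have dle v : V v -> d <= sqn (f - v).
  by move=> Vv; apply: ge_inf; [exact: iD.2|exists v].
have i0 (k : nat) : 0 < (k.+1%:R^-1 : R) by rewrite invr_gt0 ltr0n.
have /choice[v Hv] : forall k : nat, exists v, V v /\ sqn (f - v) < d + k.+1%:R^-1.
  move=> k; have [_ [v Vv <-] H] := inf_adherent (i0 k) iD.
  by exists v.
have Vv k : V (v k) by have [] := Hv k.
have Lv k : L2 (v k) by exact: VL.
have dv k : sqn (f - v k) < d + k.+1%:R^-1 by have [] := Hv k.
have small (eps : R) : 0 < eps -> exists N : nat, forall k, (N <= k)%N -> k.+1%:R^-1 < eps.
  move=> e0; have [N _ HN] := near_infty_natSinv_lt (PosNum e0).
  by exists N => k Nk; exact: HN.
(* The midpoint of [v i] and [v j] is in [V], hence at squared distance at least [d] from [f]. The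
   parallelogram law then bounds [sqn (v i - v j)] by four times the excess over [d], whence the
   tolerance [eps ^+ 2 / 4]. *)
have Cv : L2_cauchy v.
  move=> eps e0; have [|N HN] := small (eps ^+ 2 / 4).
    by rewrite divr_gt0// exprn_gt0.
  exists N => i j Ni Nj; apply: l2norm_lt => //.
  have := sqn_parallelogram (L2B Lf (Lv i)) (L2B Lf (Lv j)).
  have -> : f - v i - (f - v j) = - (v i - v j) by ring.
  have -> : f - v i + (f - v j) = cst 2 * (f - cst (2^-1) * (v i + v j)).
    apply/funext => x.
    rewrite -[LHS]/(f x - v i x + (f x - v j x)).
    by rewrite -[RHS]/(2 * (f x - 2^-1 * (v i x + v j x))); field.
  rewrite sqnN sqnZ; last by apply: L2B => //; apply: L2Z; exact: L2D.
  have -> : nsq (2 : C) = 4 by rewrite /nsq /=; ring.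
  have := dle _ (VZ 2^-1 _ (VD _ _ (Vv i) (Vv j))).
  have Hi l : (N <= l)%N -> sqn (f - v l) < d + eps ^+ 2 / 4.
    by move=> /HN Hl; apply: lt_trans (dv l) _; rewrite ltrD2l.
  move: (Hi i Ni) (Hi j Nj); set s := sqn (f - cst _ * _).
  by move: (eps ^+ 2) => E; lra.
have [p [Lp vp]] := L2_complete Lv Cv.
exists v, p; split => // w Vw; have Lw := VL _ Vw.
apply: nsq_eq0; apply: small_eq0; first exact: nsq_ge0.
move=> eps e0; have w0 : 0 < sqn w + 1 by have := sqn_ge0 w; lra.
have e1 : 0 < eps / 4 / (sqn w + 1) by rewrite !divr_gt0.
have [N HN] := small _ e1; have [M HM] := L2_cvg_sqn vp e1.
pose k := maxn N M.
have Nk := HN k (leq_maxl N M); have Mk := HM k (leq_maxr N M).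
have := dv k; move: (k.+1%:R^-1 : R) Nk => K Nk dvk.
pose z := inner (f - v k) w.
(* minimality of [sqn (f - v k)] up to [1/(k+1)], tested against [v k + t z w] *)
have zle : nsq z <= (sqn w + 1) * K.
  (* The optimal [t] would be [1 / sqn w]; adding 1 covers a null [w]. *)
  pose t := (sqn w + 1)^-1.
  have := dle _ (VD _ _ (Vv k) (VZ (t%:C%C * z) _ Vw)).
  rewrite opprD addrA sqnB//; try by [exact: L2B|exact: L2Z].
  rewrite sqnZ// innerZr//; last exact: L2B.
  rewrite -/z nsqM.
  have -> : nsq t%:C%C = t ^+ 2 by rewrite /nsq /= expr0n addr0.
  have -> : Re ((t%:C%C * z)^* * z) = t * nsq z by rewrite !ReImE /nsq /=; ring.
  have t0 : 0 < t by rewrite invr_gt0.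
  have tw : t * (sqn w + 1) = 1 by rewrite mulVf// gt_eqF.
  have s0 := sqn_ge0 w; have z0 := nsq_ge0 z; move=> H2.
  have H3 : t * nsq z * (2 - t * sqn w) <= K by move: H2 dvk; set a := nsq z; set b := sqn w; lra.
  have H4 : t * nsq z <= K.
    apply: le_trans H3; rewrite ler_peMr//; first by rewrite mulr_ge0// ltW.
    by nra.
  by rewrite -ler_pdivrMl// -/t.
have -> : inner (f - p) w = z + inner (v k - p) w.
  by rewrite /z !innerBl//; ring.
apply: le_trans (nsqD_le _ _) _.
have := cauchy_schwarz (L2B (Lv k) Lp) Lw.
move: Nk Mk; rewrite !ltr_pdivlMr// => Nk Mk H.
have := sqn_ge0 (v k - p); lra.
Qed.

(** * Partial Fourier sums, Bessel and Parseval *)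

Definition psum (a : int -> C) F : fn := \sum_(n <- F) cst (a n) * e n.

Lemma L2_mono c n : L2 (cst c * e n).
Proof. by apply: L2Z; exact: L2_expn. Qed.

Lemma L2_psum a F : L2 (psum a F).
Proof. by apply: L2_sum => n; exact: L2_mono. Qed.

Lemma inner_psum_expn a F m : uniq F ->
  inner (psum a F) (e m) = if m \in F then a m else 0.
Proof.
move=> uF; rewrite /psum inner_suml; [|by move=> n; exact: L2_mono|exact: L2_expn].
under eq_bigr do rewrite (innerZl _ (L2_expn _ _) (L2_expn _ _)) inner_expn.
case: ifPn => [mF|mF].
  rewrite (bigD1_seq m)//= eqxx mulr1 big1 ?addr0// => n /negbTE ->.
  by rewrite mulr0.
rewrite big1_seq// => n /= nF; case: eqP => [nm|_]; last by rewrite mulr0.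
by rewrite nm (negbTE mF) in nF.
Qed.

Lemma inner_psumr f a F : L2 f -> inner f (psum a F) = \sum_(n <- F) (a n)^* * fcoef f n.
Proof.
move=> Lf; rewrite /psum inner_sumr//; last by move=> n; exact: L2_mono.
by apply: eq_bigr => n _; rewrite innerZr//; exact: L2_expn.
Qed.

Lemma sqn_psum a F : uniq F -> sqn (psum a F) = \sum_(n <- F) nsq (a n).
Proof.
move=> uF; rewrite -Re_inner_self inner_psumr; last exact: L2_psum.
rewrite raddf_sum; apply: eq_big_seq => n nF.
by rewrite /fcoef inner_psum_expn// nF /= -[LHS]/(Re ((a n)^* * a n)) !ReImE /nsq; ring.
Qed.

Lemma psumB a b F : psum a F - psum b F = psum (fun n => a n - b n) F.
Proof.
rewrite /psum -sumrB; apply: eq_bigr => n _.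
by rewrite -mulrBl.
Qed.

(** The error of the Fourier sum over [F] is orthogonal to every [e_n] with [n] in [F]. Hence the
    Fourier sum is the best approximation with frequencies in [F], and [c = 0] gives Bessel's
    identity. *)
Lemma pythagoras_psum f (c : int -> C) F : L2 f -> uniq F ->
  sqn (f - psum c F) = sqn (f - psum (fcoef f) F) + sqn (psum (fun n => fcoef f n - c n) F).
Proof.
move=> Lf uF; have LS a := L2_psum a F.
have -> : f - psum c F = (f - psum (fcoef f) F) + psum (fun n => fcoef f n - c n) F.
  by rewrite -psumB; ring.
rewrite sqnD//; last exact: L2B.
rewrite inner_psumr; last exact: L2B.
rewrite big1_seq ?mulr0 ?addr0// => n /= nF.
rewrite /fcoef innerBl//; last exact: L2_expn.
by rewrite inner_psum_expn// nF subrr mulr0.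
Qed.

Lemma bessel_eq f F : L2 f -> uniq F ->
  sqn f = sqn (f - psum (fcoef f) F) + \sum_(n <- F) nsq (fcoef f n).
Proof.
move=> Lf uF; have := @pythagoras_psum f (fun=> 0) F Lf uF.
have -> : psum (fun=> 0) F = 0.
  by rewrite /psum big1// => n _; rewrite -[cst 0]/(0 : fn) mul0r.
by rewrite subr0 => ->; rewrite sqn_psum//; congr (_ + _);
  apply: eq_bigr => n _; rewrite subr0.
Qed.

Lemma bessel f F : L2 f -> uniq F -> \sum_(n <- F) nsq (fcoef f n) <= sqn f.
Proof. by move=> Lf uF; rewrite (bessel_eq Lf uF) lerDr sqn_ge0. Qed.

(** Recovers the frequencies of a trigonometric polynomial; any larger [F] also works, by padding
    with zero coefficients. *)
Lemma trigp_psum p : trigp p -> exists F0, forall F, uniq F -> {subset F0 <= F} ->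
  exists c : int -> C, p = psum c F.
Proof.
elim=> [|c n q _ [F0 IH]].
  exists [::] => F _ _; exists (fun=> 0).
  by rewrite /psum big1// => n _; rewrite -[cst 0]/(0 : fn) mul0r.
exists (n :: F0) => F uF sF.
have [|b ->] := IH F uF.
  by move=> k kF; apply: sF; rewrite inE kF orbT.
exists (fun k => b k + (if k == n then c else 0)).
have nF : n \in F by apply: sF; rewrite inE eqxx.
rewrite /psum.
under [RHS]eq_bigr => k _ do
  rewrite -[cst (b k + _)]/(cst (b k) + cst (if k == n then c else 0)) mulrDl.
rewrite big_split /= addrC; congr (_ + _).
rewrite (bigD1_seq n)//= eqxx big1 ?addr0// => k /negbTE ->.
by rewrite -[cst 0]/(0 : fn) mul0r.
Qed.

(** The projection onto the closure of the trigonometric polynomials leaves an error orthogonal to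
    all [e_n], so null by completeness. Thus some polynomial is close to [f], and Fourier sums over
    larger index sets are at least as close. *)
Lemma fourier_expansion f : L2 f -> forall eps : R, 0 < eps ->
  exists F0, forall F, uniq F -> {subset F0 <= F} ->
    l2norm (f - psum (fcoef f) F) < eps.
Proof.
move=> Lf eps e0.
have [v [p [Tv Lp vp op]]] := subspace_projection (@trigp_L2 R) (trigp0 R)
  (@trigpD R) (@trigpZ R) Lf.
have fp : sqn (f - p) = 0.
  apply: sqn_ae_zero; first exact: (L2B Lf Lp).1.
  apply: exponentials_complete; first exact: L2B.
  move=> n; apply: op; have := trigp_mono (1 : C) n.
  by rewrite -[cst 1]/(1 : fn) mul1r.
have [N /(_ N (leqnn N)) HN] := L2_cvg_sqn vp (exprn_gt0 2 e0).
have [F0 HF0] := trigp_psum (Tv N).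
exists F0 => F uF sF; apply: l2norm_lt => //.
have [c cE] := HF0 F uF sF.
have Lv : L2 (v N) by exact: trigp_L2.
have : sqn (f - v N) < eps ^+ 2.
  have -> : f - v N = (f - p) - (v N - p) by ring.
  rewrite sqnB; try exact: L2B.
  rewrite fp (_ : inner _ _ = 0) /=; first by lra.
  apply: inner_ae_zero; try exact: L2B.
  by apply: ae_zero_sqn => //; exact: L2B.
apply: le_lt_trans; rewrite cE (pythagoras_psum c Lf uF) lerDl.
exact: sqn_ge0.
Qed.

(** The half of Parseval's identity opposite to [bessel], phrased through bounds on finite sums. *)
Lemma parseval_le f (K : R) : L2 f ->
  (forall F, uniq F -> \sum_(n <- F) nsq (fcoef f n) <= K) -> sqn f <= K.
Proof.
move=> Lf HK; apply/ler_addgt0Pr => eps e0.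
have [|F0 HF0] := fourier_expansion Lf (eps := Num.sqrt eps).
  by rewrite sqrtr_gt0.
have := HF0 (undup F0) (undup_uniq _) => /(_ _)/sqn_lt H.
rewrite (bessel_eq Lf (undup_uniq F0)) addrC lerD ?HK ?undup_uniq// ltW//.
by apply: H => // x; rewrite mem_undup.
Qed.

(** Each Fourier sum of [h] is already orthogonal to [f], and these sums approximate [h]. *)
Lemma inner_disjoint_spectra f h : L2 f -> L2 h ->
  (forall n, fcoef f n = 0 \/ fcoef h n = 0) -> inner f h = 0.
Proof.
move=> Lf Lh fh; apply: nsq_eq0; apply: small_eq0; first exact: nsq_ge0.
move=> eps e0; have f0 : 0 < sqn f + 1 by have := sqn_ge0 f; lra.
have e1 := divr_gt0 e0 f0.
have [|F0 HF0] := fourier_expansion Lh (eps := Num.sqrt (eps / (sqn f + 1))).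
  by rewrite sqrtr_gt0.
have := HF0 (undup F0) (undup_uniq _) => /(_ _)/sqn_lt H.
have {H} : sqn (h - psum (fcoef h) (undup F0)) < eps / (sqn f + 1).
  by apply: H => // x; rewrite mem_undup.
set S := psum _ _; have LS : L2 S by exact: L2_psum.
rewrite ltr_pdivlMr// => H.
have -> : inner f h = inner f (h - S).
  rewrite innerBr// inner_psumr// big1 ?subr0// => n _.
  by case: (fh n) => ->; rewrite ?mulr0// conjC0 mul0r.
apply: le_trans (cauchy_schwarz Lf (L2B Lh LS)) _.
by have := sqn_ge0 (h - S); lra.
Qed.

End hilbert.

(** * Toeplitz operators and the flip *)

Section toeplitz.
Variable R : realType.
Local Notation C := R[i].
Local Notation fn := (R -> C).
Local Notation e := (@Defs.expn R).
Implicit Types (f g h u v w : fn) (z c : C) (m n : int) (F : seq int).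

Lemma esum_le (a : int -> R) (K : R) :
  (forall F, uniq F -> \sum_(n <- F) a n <= K) ->
  (\esum_(n in [set: int]) (a n)%:E <= K%:E)%E.
Proof.
move=> aK; apply: ge_ereal_sup => _ [A [fA _] <-].
by rewrite fsbig_finite//= sumEFin lee_fin aK// finmap.fset_uniq.
Qed.

Lemma esum_ge_seq (a : int -> R) F : uniq F ->
  ((\sum_(n <- F) a n)%:E <= \esum_(n in [set: int]) (a n)%:E)%E.
Proof.
move=> uF; apply: esum_ge; exists [set` F]; first by split => //; exact: finite_seq.
by rewrite -fsbig_seq// sumEFin.
Qed.

Lemma fcoefD f h n : L2 f -> L2 h -> fcoef (f + h) n = fcoef f n + fcoef h n.
Proof. by move=> Lf Lh; rewrite /fcoef innerDl//; exact: L2_expn. Qed.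

Lemma fcoefB f h n : L2 f -> L2 h -> fcoef (f - h) n = fcoef f n - fcoef h n.
Proof. by move=> Lf Lh; rewrite /fcoef innerBl//; exact: L2_expn. Qed.

Lemma fcoefZ c f n : L2 f -> fcoef (cst c * f) n = c * fcoef f n.
Proof. by move=> Lf; rewrite /fcoef innerZl//; exact: L2_expn. Qed.

Lemma fcoef0 n : fcoef (0 : fn) n = 0.
Proof. exact: inner0l. Qed.

Lemma fcoef_expn m n : fcoef (e m) n = (m == n)%:R.
Proof. exact: inner_expn. Qed.

Lemma L2_mul g f : Linf g -> L2 f -> L2 (g * f).
Proof. by move=> /Linf_mul[M [_ gM]] /gM[]. Qed.

Lemma H2_0 : H2 (0 : fn).
Proof. by split; [exact: L20|move=> n _; exact: fcoef0]. Qed.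

Lemma H2D f h : H2 f -> H2 h -> H2 (f + h).
Proof.
move=> [Lf f0] [Lh h0]; split; first exact: L2D.
by move=> n n0; rewrite fcoefD// f0// h0// addr0.
Qed.

Lemma H2B f h : H2 f -> H2 h -> H2 (f - h).
Proof.
move=> [Lf f0] [Lh h0]; split; first exact: L2B.
by move=> n n0; rewrite fcoefB// f0// h0// subr0.
Qed.

Lemma H2Z c f : H2 f -> H2 (cst c * f).
Proof.
move=> [Lf f0]; split; first exact: L2Z.
by move=> n n0; rewrite fcoefZ// f0// mulr0.
Qed.

Lemma H2_expn n : 0 <= n -> H2 (e n).
Proof.
move=> n0; split; first exact: L2_expn.
move=> m m0; rewrite fcoef_expn; case: eqP => // nm.
by move: n0; rewrite nm leNgt m0.
Qed.

Lemma H2_lim (v : nat -> fn) f : (forall k, H2 (v k)) -> L2 f -> L2_cvg v f -> H2 f.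
Proof.
move=> Hv Lf vf; split => // n n0.
apply: (inner_lim0 _ Lf (L2_expn R n) vf) => k; first exact: (Hv k).1.
exact: (Hv k).2.
Qed.

(** Testing on [e_n] gives the coefficients. Conversely [h - u] has only negative frequencies, and
    elements of [H2] have none. *)
Lemma is_PplusP h u : L2 h ->
  is_Pplus h u <-> H2 u /\ forall n, 0 <= n -> fcoef u n = fcoef h n.
Proof.
move=> Lh; split=> -[Hu Huv]; split => //; have Lu := Hu.1.
  move=> n n0; have := Huv _ (H2_expn n0).
  rewrite -[inner _ _]/(fcoef (h - u) n) fcoefB// => /eqP.
  by rewrite subr_eq0 => /eqP.
move=> v [Lv v0]; apply: (@inner_disjoint_spectra R (h - u) v) => //; first exact: L2B.
move=> n; have [n0|n0] := leP 0 n; last by right; exact: v0.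
by left; rewrite fcoefB// Huv// subrr.
Qed.

Lemma Pplus_exists h : L2 h -> exists u, is_Pplus h u.
Proof.
move=> Lh; have [v [p [Hv Lp vp op]]] := subspace_projection
  (fun v (Hv : H2 v) => Hv.1) H2_0 H2D H2Z Lh.
by exists p; split => //; exact: H2_lim vp.
Qed.

Lemma toeplitzP g f u : Linf g -> L2 f ->
  toeplitz g f u <-> H2 u /\ forall n, 0 <= n -> fcoef u n = fcoef (g * f) n.
Proof. by move=> Lg Lf; apply: is_PplusP; exact: L2_mul. Qed.

Lemma toeplitz_exists g f : Linf g -> L2 f -> exists u, toeplitz g f u.
Proof. by move=> Lg Lf; apply: Pplus_exists; exact: L2_mul. Qed.

Lemma toeplitzB g f f' u u' : Linf g -> L2 f -> L2 f' ->
  toeplitz g f u -> toeplitz g f' u' -> toeplitz g (f - f') (u - u').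
Proof.
move=> Lg Lf Lf' /(toeplitzP _ Lg Lf)[Hu fu] /(toeplitzP _ Lg Lf')[Hu' fu'].
apply/toeplitzP => //; first exact: L2B.
split; first exact: H2B.
move=> n n0; rewrite mulrBr !fcoefB ?fu ?fu'//;
  by [exact: L2_mul|exact: Hu.1|exact: Hu'.1].
Qed.

Lemma toeplitzD g f f' u u' : Linf g -> L2 f -> L2 f' ->
  toeplitz g f u -> toeplitz g f' u' -> toeplitz g (f + f') (u + u').
Proof.
move=> Lg Lf Lf' /(toeplitzP _ Lg Lf)[Hu fu] /(toeplitzP _ Lg Lf')[Hu' fu'].
apply/toeplitzP => //; first exact: L2D.
split; first exact: H2D.
move=> n n0; rewrite mulrDr !fcoefD ?fu ?fu'//;
  by [exact: L2_mul|exact: Hu.1|exact: Hu'.1].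
Qed.

Lemma toeplitzZ g c f u : Linf g -> L2 f ->
  toeplitz g f u -> toeplitz g (cst c * f) (cst c * u).
Proof.
move=> Lg Lf /(toeplitzP _ Lg Lf)[Hu fu]; apply/toeplitzP => //; first exact: L2Z.
split; first exact: H2Z.
move=> n n0; rewrite mulrCA !fcoefZ ?fu//; by [exact: L2_mul|exact: Hu.1].
Qed.

(** The Fourier series of [T_g f] is a truncation of that of [g * f], so its norm is no larger. *)
Lemma toeplitz_bounded_Linf g : Linf g -> toeplitz_bounded g.
Proof.
move=> Lg; have [M [M0 gM]] := Linf_mul Lg; exists M => f u [Lf _].
move=> /(toeplitzP _ Lg Lf)[[Lu u0] fu].
have [Lgf] := gM _ Lf; apply: le_trans.
rewrite /l2norm -!/(sqn _) ler_wsqrtr//; apply: parseval_le => // F uF.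
apply: le_trans (bessel Lgf uF); apply: ler_sum => n _.
by have [/fu ->//|/u0 ->] := leP 0 n; rewrite nsq0 nsq_ge0.
Qed.

Lemma ae_zero_fcoef f : L2 f -> (forall n, 0 <= n -> fcoef f n = 0) ->
  (forall n, n < 0 -> fcoef f n = 0) -> ae_zero f.
Proof.
move=> Lf f0 f1; apply: exponentials_complete => // n.
by have [/f0|/f1] := leP 0 n.
Qed.

(* The antilinear isometry [e_n -> e_(-n-1)], exchanging [H2] and its orthogonal
   complement; it conjugates the compression of [g] to that complement into [T_g]. *)
Definition flip f : fn := conjf (e 1 * f).

Lemma flipK : involutive flip.
Proof.
move=> f; rewrite /flip conjfM conjfK conjf_expn mulrCA mulrA.
by rewrite -cexpD subrr cexp0 mul1r.
Qed.

Lemma L2_flip f : L2 f -> L2 (flip f).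
Proof. by move=> Lf; apply: L2_conj; apply: L2_mul => //; exact: Linf_expn. Qed.

Lemma sqn_flip f : sqn (flip f) = sqn f.
Proof.
congr (Rintegral _ _ _); apply/funext => x.
by rewrite /flip /conjf nsq_conj nsqM nsq_expn mul1r.
Qed.

Lemma l2norm_flip f : l2norm (flip f) = l2norm f.
Proof. by rewrite /l2norm -!/(sqn _) sqn_flip. Qed.

Lemma fcoef_flip f n : L2 f -> fcoef (flip f) n = (fcoef f (- n - 1))^*.
Proof.
move=> Lf; rewrite /fcoef !innerE -cint_conj; last first.
  by apply: L2M_cintegrable => //; apply: L2_conj; exact: L2_expn.
congr cint; rewrite /flip !conjfM conjfK !conjf_expn cexpD; ring.
Qed.

Lemma flip_mul g f : flip (g * f) = conjf g * flip f.
Proof. by rewrite /flip (mulrCA (e 1) g f) (conjfM g). Qed.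

Lemma flip_index_ge0 n : (0 <= - n - 1) = (n < 0).
Proof. by lia. Qed.

Lemma flip_index_lt0 n : (- n - 1 < 0) = (0 <= n).
Proof. by lia. Qed.

Lemma flip_indexK : involutive (fun n : int => - n - 1).
Proof. by move=> n; ring. Qed.

Lemma fcoef_mul_flip g f n : Linf g -> L2 f ->
  fcoef (conjf g * flip f) n = (fcoef (g * f) (- n - 1))^*.
Proof. by move=> Lg Lf; rewrite -flip_mul fcoef_flip//; exact: L2_mul. Qed.

Lemma ae_zero_flip f : L2 f -> ae_zero (flip f) -> ae_zero f.
Proof.
move=> Lf /(sqn_ae_zero (L2_flip Lf).1); rewrite sqn_flip.
exact: ae_zero_sqn.
Qed.

Lemma fcoef_flip_H2 f n : H2 f -> 0 <= n -> fcoef (flip f) n = 0.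
Proof. by move=> [Lf f0] n0; rewrite fcoef_flip// f0 ?conjC0// flip_index_lt0. Qed.

Lemma H2_flip f : L2 f -> (forall n, 0 <= n -> fcoef f n = 0) -> H2 (flip f).
Proof.
move=> Lf f0; split; first exact: L2_flip.
by move=> n n0; rewrite fcoef_flip// f0 ?conjC0// flip_index_ge0.
Qed.

Lemma Fam_ge0 g n : 0 <= n -> Fam g n = e n.
Proof. by rewrite /Fam => ->. Qed.

Lemma Fam_lt0 g n : n < 0 -> Fam g n = g * e n.
Proof. by rewrite /Fam leNgt => ->. Qed.

Lemma L2_Fam g n : Linf g -> L2 (Fam g n).
Proof.
move=> Lg; have [/(Fam_ge0 g)->|/(Fam_lt0 g)->] := leP 0 n; first exact: L2_expn.
by apply: L2_mul => //; exact: L2_expn.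
Qed.

Lemma inner_Fam g f n :
  inner f (Fam g n) = if 0 <= n then fcoef f n else fcoef (conjf g * f) n.
Proof.
have [n0|n0] := leP 0 n; first by rewrite Fam_ge0.
by rewrite Fam_lt0// /fcoef inner_mull conjfK.
Qed.

(** For [n < 0] the left side is a coefficient of [flip (g * f)] by [flip_mul]. It is read at the
    index [- n - 1 >= 0] of [g * f], where [g * f] and [u] agree. *)
Lemma inner_flip_Fam g f u n : Linf g -> H2 f -> toeplitz g f u ->
  inner (flip f) (Fam g n) = if 0 <= n then 0 else (fcoef u (- n - 1))^*.
Proof.
move=> Lg Hf /(toeplitzP _ Lg Hf.1)[Hu fu]; rewrite inner_Fam.
have [n0|n0] := leP 0 n; first exact: fcoef_flip_H2.
by rewrite fcoef_mul_flip// ?fu ?flip_index_ge0//; exact: Hf.1.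
Qed.

Lemma complete_iff_injective g : Linf g ->
  complete_fam (Fam g) <-> toeplitz_injective g.
Proof.
move=> Lg; split=> [Cg f u Hf Tfu u0|Ig f Lf f0].
  have Lf := Hf.1; have Lu := Tfu.1.1.
  apply: ae_zero_flip => //; apply: Cg; first exact: L2_flip.
  move=> n; rewrite (inner_flip_Fam n Lg Hf Tfu); case: ifPn => // _.
  by rewrite /fcoef inner_ae_zero ?conjC0//; exact: L2_expn.
(* Orthogonality to the members with [n >= 0] puts [f] in the complement of [H2], so [f] is the flip
   of an element of [H2]. *)
have Hf : H2 (flip f).
  by apply: H2_flip => // n n0; have := f0 n; rewrite inner_Fam n0.
have [u Tu] := toeplitz_exists Lg Hf.1.
apply: ae_zero_flip => //; apply: (Ig _ _ Hf Tu); apply: ae_zero_fcoef; [exact: Tu.1.1| |exact: Tu.1.2].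
move=> n n0; have := inner_flip_Fam (- n - 1) Lg Hf Tu.
rewrite flipK f0 leNgt flip_index_lt0 n0 /= flip_indexK => /esym /eqP.
by rewrite conjC_eq0 => /eqP.
Qed.

End toeplitz.

(** * Frames and Riesz bases *)

Section main.
Variable R : realType.
Local Notation C := R[i].
Local Notation fn := (R -> C).
Local Notation e := (@Defs.expn R).
Implicit Types (f g h u v w : fn) (z c : C) (m n : int) (F : seq int).

(** * Frame bounds and boundedness below *)

Lemma sum_flip_index (a : int -> R) F :
  \sum_(n <- F) a (- n - 1) = \sum_(n <- map (fun n => - n - 1) F) a n.
Proof. by rewrite big_map. Qed.

Lemma uniq_flip_index F : uniq F -> uniq (map (fun n : int => - n - 1) F).
Proof. by move=> uF; rewrite map_inj_uniq//; exact: inv_inj flip_indexK. Qed.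

(** The lower frame bound is tested on [flip f], whose coefficients are conjugate to those of [u]
    and are summed by Bessel. *)
Lemma frame_bounded_below g : Linf g -> frame_fam (Fam g) -> toeplitz_bounded_below g.
Proof.
move=> Lg [A [B [A0 [_ fr]]]]; exists (Num.sqrt A); split; first by rewrite sqrtr_gt0.
move=> f u Hf Tu; have Lu := Tu.1.1.
have [+ _] := fr _ (L2_flip Hf.1).
have /(@esum_le R) H : forall F, uniq F ->
    \sum_(n <- F) nsq (inner (flip f) (Fam g n)) <= sqn u.
  move=> F uF; apply: le_trans (bessel Lu (uniq_flip_index uF)).
  rewrite -(sum_flip_index (fun n => nsq (fcoef u n))); apply: ler_sum => n _.
  rewrite (inner_flip_Fam n Lg Hf Tu); case: ifPn => _; last by rewrite nsq_conj.
  by rewrite nsq0 nsq_ge0.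
move=> /le_trans/(_ H); rewrite lee_fin sqr_l2norm sqn_flip => AH.
by rewrite /l2norm -!/(sqn _) -sqrtrM ?(ltW A0)// ler_wsqrtr.
Qed.

(** Split [f] into [fp] in [H2] and a remainder. The coefficients with [n >= 0] control [fp]; the
    others, corrected by the contribution of [fp], are those of [T_g] on the flipped remainder,
    which boundedness below then controls. *)
Lemma bounded_below_frame g : Linf g -> toeplitz_bounded_below g -> frame_fam (Fam g).
Proof.
move=> Lg [c [c0 Tc]]; have Lg' := Linf_conj Lg.
have [M [M0 gM]] := Linf_mul Lg'.
have gM2 f : L2 f -> sqn (conjf g * f) <= M ^+ 2 * sqn f.
  by move=> Lf; have [_] := gM _ Lf; rewrite l2norm_le_sqn.
(* From [sqn f <= 2 sqn fp + 2 sqn (f - fp)] together with the bounds [fpK] and [fmK] below. *)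
pose D := 2 + (4 + 4 * M ^+ 2) / c ^+ 2.
have D0 : 0 < D.
  by rewrite /D ltr_wpDr// divr_ge0 ?sqr_ge0// addr_ge0// mulr_ge0 ?sqr_ge0.
(* Bessel for [f] and for [conj g f] gives the upper bound [1 + M ^+ 2]; the maximum secures
   [A <= B]. *)
exists D^-1, (Num.max D^-1 (1 + M ^+ 2)); split; first by rewrite invr_gt0.
split; first by rewrite le_max lexx.
move=> f Lf; rewrite sqr_l2norm; have Lgf := L2_mul Lg' Lf; split; last first.
  apply: esum_le => F uF.
  apply: (@le_trans _ _ ((1 + M ^+ 2) * sqn f)); last first.
    by rewrite ler_wpM2r ?sqn_ge0// le_max lexx orbT.
  rewrite mulrDl mul1r; apply: le_trans (lerD (bessel Lf uF) (gM2 _ Lf)).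
  apply: le_trans (lerD (lexx _) (bessel Lgf uF)).
  rewrite -big_split /=; apply: ler_sum => n _; rewrite inner_Fam.
  by case: ifPn => _; rewrite ?lerDl ?lerDr nsq_ge0.
have H F := @esum_ge_seq R (fun n => nsq (inner f (Fam g n))) F.
(* An infinite sum satisfies the lower bound trivially, and the empty finite sum excludes minus
   infinity. What remains is a real [K] above all finite sums. *)
move: H; case: esum => [K|_|H]; last 2 first.
  exact: leey.
  by have := H [::] isT; rewrite big_nil.
move=> H; have {}H F : uniq F -> \sum_(n <- F) nsq (inner f (Fam g n)) <= K.
  by move=> /H; rewrite lee_fin.
rewrite lee_fin ler_pdivrMl//.
have [fp /(is_PplusP _ Lf)[Hfp fpE]] := Pplus_exists Lf; have Lfp := Hfp.1.
have Lfm : L2 (f - fp) by exact: L2B.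
have fpK : sqn fp <= K.
  apply: parseval_le => // F uF; apply: le_trans (H F uF); apply: ler_sum => n _.
  rewrite inner_Fam; have [n0|n0] := leP 0 n; first by rewrite fpE.
  by rewrite Hfp.2// nsq0 nsq_ge0.
have Hm : H2 (flip (f - fp)).
  by apply: H2_flip => // n n0; rewrite fcoefB// fpE// subrr.
have [u Tu] := toeplitz_exists Lg Hm.1; have Lu := Tu.1.1.
(* Up to conjugation, a coefficient of [u] at index at least 0 is a coefficient of [f] against the
   family minus one of [conj g * fp]. The two parts contribute [2 K] and [2 M^2 K]. *)
have uK : sqn u <= 2 * K + 2 * (M ^+ 2 * K).
  apply: parseval_le => // F uF.
  apply: (@le_trans _ _ (\sum_(n <- map (fun n => - n - 1) F)
      (2 * nsq (if n < 0 then inner f (Fam g n) else 0) +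
       2 * nsq (fcoef (conjf g * fp) n)))).
    rewrite -(sum_flip_index (fun n => 2 * nsq (if n < 0 then inner f (Fam g n) else 0) +
       2 * nsq (fcoef (conjf g * fp) n))).
    apply: ler_sum => n _; rewrite flip_index_lt0; case: ifPn => [n0|]; last first.
      rewrite -ltNge => /(Tu.1.2) ->; rewrite nsq0.
      by rewrite addr_ge0// mulr_ge0// nsq_ge0.
    have := inner_flip_Fam (- n - 1) Lg Hm Tu; rewrite flipK.
    rewrite leNgt flip_index_lt0 n0 /= flip_indexK => uE.
    rewrite -(nsq_conj (fcoef u n)) -uE !inner_Fam !flip_index_ge0 !(ltNge n) n0 /=.
    rewrite mulrBr fcoefB//; last exact: L2_mul.
    rewrite -(nsq_conj (fcoef (_ * fp) _)) -[X in _ <= _ + 2 * X]nsq_conj conjCK.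
    apply: le_trans (nsqD_le _ _) _; rewrite lerD2l.
    by rewrite {1}/nsq !ReImE !sqrrN.
  rewrite big_split /= -!mulr_sumr; have uF' := uniq_flip_index uF.
  rewrite lerD// ler_wpM2l//.
    apply: le_trans (H _ uF'); apply: ler_sum => n _.
    by case: ifPn => // _; rewrite nsq0 nsq_ge0.
  apply: le_trans (bessel _ uF') _; first exact: L2_mul.
  by apply: le_trans (gM2 _ Lfp) _; rewrite ler_wpM2l// sqr_ge0.
have fmK : sqn (f - fp) <= (2 + 2 * M ^+ 2) / c ^+ 2 * K.
  have := Tc _ _ Hm Tu; rewrite l2norm_flip => Tcu.
  have c2 : 0 < c ^+ 2 by rewrite exprn_gt0.
  rewrite mulrAC ler_pdivlMr// mulrC -sqr_l2norm -exprMn.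
  apply: (@le_trans _ _ (sqn u)); last by apply: le_trans uK _; lra.
  rewrite -(sqr_l2norm u) ler_pXn2r ?nnegrE ?l2norm_ge0//.
  by rewrite mulr_ge0 ?l2norm_ge0 ?ltW.
have -> : f = (f - fp) + fp by rewrite subrK.
have := sqn_parallelogram Lfm Lfp; have := sqn_ge0 (f - fp - fp).
have K0 : 0 <= K by apply: le_trans fpK; exact: sqn_ge0.
rewrite /D; move: fmK fpK; move: (c ^+ 2)^-1 => b; move: (M ^+ 2) => a; nra.
Qed.

(** * Surjectivity, expansions and invertibility *)

Lemma bounded_below_injective g : toeplitz_bounded_below g -> toeplitz_injective g.
Proof.
move=> [c [c0 Tc]] f u Hf Tu u0; apply/(l2norm_eq0 Hf.1).
have := Tc _ _ Hf Tu; rewrite ((l2norm_eq0 Tu.1.1).2 u0) => H.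
apply/eqP; rewrite eq_le l2norm_ge0 andbT.
by rewrite -(pmulr_rle0 _ c0).
Qed.

(* Boundedness below makes the range closed; its orthogonal complement is the
   kernel of the adjoint [T_(conj g)]. *)
Lemma toeplitz_surjective g : Linf g -> toeplitz_bounded_below g ->
  toeplitz_injective (conjf g) -> forall u, H2 u -> exists f, H2 f /\ toeplitz g f u.
Proof.
move=> Lg [c [c0 Tc]] Ig u Hu; have Lu := Hu.1; have Lg' := Linf_conj Lg.
pose V v := exists f, H2 f /\ toeplitz g f v.
have VL v : V v -> L2 v by move=> [f [_ Tf]]; exact: Tf.1.1.
have V0 : V 0.
  exists 0; split; first exact: H2_0.
  apply/toeplitzP => //; first exact: L20.
  by split; [exact: H2_0|move=> n _; rewrite mulr0].
have VD v w : V v -> V w -> V (v + w).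
  move=> [f [Hf Tf]] [h [Hh Th]]; exists (f + h); split; first exact: H2D.
  by apply: toeplitzD => //; [exact: Hf.1|exact: Hh.1].
have VZ k v : V v -> V (cst k * v).
  move=> [f [Hf Tf]]; exists (cst k * f); split; first exact: H2Z.
  by apply: toeplitzZ => //; exact: Hf.1.
have [v [p [Vv Lp vp op]]] := subspace_projection VL V0 VD VZ Lu.
have /choice[f Hf] := Vv.
have Hfk k : H2 (f k) by have [] := Hf k.
have Lfk k : L2 (f k) by exact: (Hfk k).1.
have Tfk k : toeplitz g (f k) (v k) by have [] := Hf k.
have Lv k : L2 (v k) by exact: VL.
(* Boundedness below carries the Cauchy property from the images back to the preimages. *)
have Cf : L2_cauchy f.
  move=> eps e0; have [N HN] := L2_cvg_cauchy Lv Lp vp (mulr_gt0 c0 e0).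
  exists N => i j Ni Nj; rewrite -(ltr_pM2l c0); apply: le_lt_trans (HN i j Ni Nj).
  by apply: Tc; [exact: H2B|exact: toeplitzB].
have [q [Lq fq]] := L2_complete Lfk Cf.
have Hq : H2 q by exact: H2_lim fq.
have Hp : H2 p by apply: (H2_lim _ Lp vp) => k; exact: (Tfk k).1.
have Hup := H2B Hu Hp.
have Lgq := L2_mul Lg Lq.
have Tq : toeplitz g q p.
  apply/toeplitzP => //; split => // n n0; apply/eqP; rewrite eq_sym -subr_eq0 -fcoefB//.
  have Lgf k := L2_mul Lg (Lfk k).
  apply/eqP; apply: (inner_lim0 _ _ (L2_expn R n) (L2_cvgB Lgf Lv Lgq Lp (L2_cvg_mul Lg Lfk Lq fq) vp)).
  - by move=> k; exact: L2B.
  - exact: L2B.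
  - move=> k; rewrite -[LHS]/(fcoef (g * f k - v k) n) fcoefB//.
    by have /(toeplitzP _ Lg (Lfk k))[_ ->//] := Tfk k; rewrite subrr.
(* The coefficient of [conj g * (u - p)] at [n >= 0] is conjugate to the inner product of [T_g e_n]
   with [u - p], which is 0 because [T_g e_n] is in the range. So [T_(conj g)] kills [u - p]. *)
have up0 : ae_zero (u - p).
  apply: (Ig _ 0 Hup); last by apply: aeW.
  apply/toeplitzP => //; first exact: Hup.1.
  split; first exact: H2_0.
  move=> n n0; rewrite fcoef0 /fcoef inner_mull conjfK.
  have [t Tt] := toeplitz_exists Lg (L2_expn R n).
  have Lt := Tt.1.1; have Lge := L2_mul Lg (L2_expn R n).
  have Vt : V t by exists (e n); split => //; exact: H2_expn.
  have := Tt.2 _ Hup; rewrite -[inner _ _]/(inner (g * e n - t) (u - p)).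
  rewrite (innerBl Lge Lt Hup.1) => /eqP; rewrite subr_eq0 => /eqP H.
  rewrite (inner_conj Lge Hup.1).
  by rewrite H -(inner_conj Lt Hup.1) op.
exists q; split => //; apply/toeplitzP => //; split => // n n0.
move/(toeplitzP _ Lg Lq) : Tq => [_ <-//].
apply/eqP; rewrite -subr_eq0 -fcoefB// /fcoef inner_ae_zero//; first exact: Hup.1.
exact: L2_expn.
Qed.

Lemma expansionE (h : int -> fn) (a : int -> C) f F :
  (fun x => f x - \sum_(n <- F) a n * h n x) = f - \sum_(n <- F) cst (a n) * h n.
Proof.
apply/funext => x; rewrite -[RHS]/(f x - (\sum_(n <- F) cst (a n) * h n) x).
by rewrite fct_sumE.
Qed.

(** Merges the Fourier series of [f - g * w], with frequencies [n >= 0], and [g] times that of [w],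
    with frequencies [n < 0]. Multiplication by [g] preserves norm convergence. *)
Lemma expansion_Fam g f w : Linf g -> L2 f -> L2 w ->
  (forall n, 0 <= n -> fcoef w n = 0) -> H2 (f - g * w) ->
  expansion (Fam g) (fun n => if 0 <= n then fcoef (f - g * w) n else fcoef w n) f.
Proof.
move=> Lg Lf Lw w0 [Ld d0] eps e0; set d := f - g * w in Ld d0 *.
have [M [M0 gM]] := Linf_mul Lg; have M1 : 0 < M + 1 by lra.
have e2 : 0 < eps / 2 by rewrite divr_gt0.
have [F1 HF1] := fourier_expansion Ld e2.
have [F2 HF2] := fourier_expansion Lw (divr_gt0 e2 M1).
exists (F1 ++ F2) => F uF sF; rewrite expansionE.
have H1 : l2norm (d - psum (fcoef d) F) < eps / 2.
  by apply: HF1 => // x xF; apply: sF; rewrite mem_cat xF.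
have {HF2} H2 : l2norm (w - psum (fcoef w) F) < eps / 2 / (M + 1).
  by apply: HF2 => // x xF; apply: sF; rewrite mem_cat xF orbT.
have -> : \sum_(n <- F) cst (if 0 <= n then fcoef d n else fcoef w n) * Fam g n =
    psum (fcoef d) F + g * psum (fcoef w) F.
  rewrite /psum mulr_sumr -big_split; apply: eq_bigr => n _ /=.
  case: ifPn => [n0|]; first by rewrite Fam_ge0// w0// -[cst 0]/(0 : fn) mul0r mulr0 addr0.
  rewrite -ltNge => n0; rewrite Fam_lt0// d0// -[cst 0]/(0 : fn) mul0r add0r; ring.
have -> : f - (psum (fcoef d) F + g * psum (fcoef w) F) =
    (d - psum (fcoef d) F) + g * (w - psum (fcoef w) F) by rewrite /d; ring.
have LS (a : int -> C) := L2_psum a F; have Lwp := L2B Lw (LS (fcoef w)).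
have [Lgw gw] := gM _ Lwp.
apply: le_lt_trans (l2normD _ _) _ => //; first exact: L2B.
move: H2 gw; rewrite ltr_pdivlMr//; have := l2norm_ge0 (w - psum (fcoef w) F).
move: (l2norm (w - _)) (l2norm (g * _)) => x y x0 xe yM.
by have : M * x <= x * (M + 1) by [rewrite mulrDr mulr1 mulrC lerDl]; lra.
Qed.

(** A function biorthogonal to the family reads off a coefficient of any expansion by continuity of
    the inner product, which yields uniqueness. *)
Lemma expansion_coef (h : int -> fn) (a : int -> C) f k m : (forall n, L2 (h n)) ->
  L2 f -> L2 k -> (forall n, inner (h n) k = (n == m)%:R) -> expansion h a f ->
  a m = inner f k.
Proof.
move=> Lh Lf Lk hk ex; apply/esym/eqP; rewrite -subr_eq0; apply/eqP.
apply: nsq_eq0; apply: small_eq0; first exact: nsq_ge0.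
move=> eps e0; have k0 : 0 < sqn k + 1 by have := sqn_ge0 k; lra.
have e1 := divr_gt0 e0 k0.
have [|F0 HF0] := ex (Num.sqrt (eps / (sqn k + 1))); first by rewrite sqrtr_gt0.
pose F := undup (m :: F0); have uF : uniq F by exact: undup_uniq.
have mF : m \in F by rewrite mem_undup mem_head.
have := HF0 F uF; rewrite expansionE; set S := \sum_(_ <- _) _ => /(_ _)/sqn_lt H.
have {H} : sqn (f - S) < eps / (sqn k + 1).
  by apply: H => // x xF; rewrite mem_undup inE xF orbT.
have Lt n : L2 (cst (a n) * h n) by exact: L2Z.
have LS : L2 S by exact: L2_sum.
have -> : inner f k - a m = inner (f - S) k.
  rewrite innerBl//; congr (_ - _); rewrite inner_suml//.
  rewrite (bigD1_seq m)//= innerZl// hk eqxx mulr1 big1 ?addr0// => n /negbTE nm.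
  by rewrite innerZl// hk nm mulr0.
rewrite ltr_pdivlMr// => H.
apply: le_trans (cauchy_schwarz (L2B Lf LS) Lk) _.
by have := sqn_ge0 (f - S); lra.
Qed.

Lemma biorthogonal_Fam g m : Linf g ->
  (forall u, H2 u -> exists f, H2 f /\ toeplitz g f u) ->
  exists k, L2 k /\ forall n, inner (Fam g n) k = (n == m)%:R.
Proof.
move=> Lg Sg; have Lg' := Linf_conj Lg.
suff [k [Lk Hk]] : exists k, L2 k /\ forall n, inner k (Fam g n) = (n == m)%:R.
  exists k; split => // n; rewrite inner_conj//; last exact: L2_Fam.
  by rewrite Hk conjC_nat.
(* the component in [H2] is forced, the other one solves a Toeplitz equation *)
suff [kp [y [Lkp Ly k0 k1]]] : exists kp y, [/\ L2 kp, L2 y,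
    forall n, 0 <= n -> fcoef kp n = (n == m)%:R &
    forall n, n < 0 -> fcoef (conjf g * kp) n + fcoef y n = (n == m)%:R].
  (* Solving [T_g f = P_+ (flip y)] makes the coefficients of [flip f] against the family 0 for
     [n >= 0] and those of [y] for [n < 0], exactly the correction that [kp] lacks. *)
  have [U TU] := Pplus_exists (L2_flip Ly).
  have /(is_PplusP _ (L2_flip Ly))[HU UE] := TU.
  have [f [Hf Tf]] := Sg _ HU; have Lf := Hf.1; have Lff := L2_flip Lf.
  exists (kp + flip f); split; first exact: L2D.
  move=> n; rewrite innerDl//; last exact: L2_Fam.
  rewrite (inner_flip_Fam n Lg Hf Tf) inner_Fam.
  have [n0|n0] := leP 0 n; first by rewrite addr0 k0.
  by rewrite UE ?flip_index_ge0// fcoef_flip// flip_indexK conjCK k1.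
have [m0|m0] := leP 0 m.
  exists (e m), (- (conjf g * e m)); have Le := L2_expn R m.
  have Lge := L2_mul Lg' Le; split => //; first exact: L2N.
    by move=> n _; rewrite fcoef_expn eq_sym.
  move=> n n0; rewrite -fcoefD//; last exact: L2N.
  rewrite subrr fcoef0; case: eqP => // nm.
  by move: m0; rewrite -nm leNgt n0.
exists 0, (e m); split; [exact: L20|exact: L2_expn| |].
  move=> n n0; rewrite fcoef0; case: eqP => // nm.
  by move: m0; rewrite -nm ltNge n0.
by move=> n n0; rewrite mulr0 fcoef0 add0r fcoef_expn eq_sym.
Qed.

(** Transfers the bound on the inverse to [f], which [S (T_g f)] equals only almost everywhere;
    [|K| + 1] is a positive constant that can be inverted. *)
Lemma ae_eq_l2norm_le f s u (K : R) : L2 f -> L2 s -> Defs.ae_eq s f ->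
  l2norm s <= K * l2norm u -> l2norm f <= (`|K| + 1) * l2norm u.
Proof.
move=> Lf Ls /(ae_eq_sqnP Ls Lf) sf sK.
have sf0 : l2norm (s - f) = 0 by rewrite /l2norm -/(sqn _) sf sqrtr0.
have -> : f = s - (s - f) by rewrite subKr.
apply: le_trans (l2normB Ls (L2B Ls Lf)) _; rewrite sf0 addr0 (le_trans sK)//.
by rewrite ler_wpM2r ?l2norm_ge0// (le_trans (ler_norm _))// lerDl.
Qed.

Lemma riesz_invertible g : Linf g -> riesz_basis_fam (Fam g) -> toeplitz_invertible g.
Proof.
move=> Lg [fr un]; have Lg' := Linf_conj Lg.
have [c [c0 Tc]] := frame_bounded_below Lg fr.
have Ig : toeplitz_injective (conjf g).
  move=> v u Hv Tu u0; have Lv := Hv.1; have Lw := L2_flip Lv.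
  have /(toeplitzP _ Lg' Lv)[[Lu _] uE] := Tu.
  have L0 := L20 R; have Lgw := L2_mul Lg Lw.
  have w0 n : 0 <= n -> fcoef (flip v) n = 0 by exact: fcoef_flip_H2.
  (* For [v] in the kernel of [T_(conj g)], [g * flip v] lies in [H2]. Then [0 = - g w + g w] with
     [w = flip v] gives an expansion of 0, to be compared with the trivial one. *)
  have H0 : H2 (0 - g * flip v).
    split; first exact: L2B.
    move=> n n0; rewrite fcoefB// fcoef0 sub0r -{1}(conjfK g) fcoef_mul_flip//.
    rewrite -uE ?flip_index_ge0// /fcoef inner_ae_zero ?conjC0 ?oppr0//.
    exact: L2_expn.
  have ex1 := expansion_Fam Lg L0 Lw w0 H0.
  have H0' : H2 (0 - g * 0 : fn) by rewrite mulr0 subr0; exact: H2_0.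
  have ex2 := expansion_Fam Lg L0 L0 (fun n _ => @fcoef0 R n) H0'.
  have [a [_ ua]] := un _ L0.
  have ab := etrans (ua _ ex1) (esym (ua _ ex2)).
  apply: ae_zero_flip => //; apply: ae_zero_fcoef => // n n0.
  have := congr1 (fun a => a n) ab.
  by rewrite /= leNgt n0 /= fcoef0.
have Sg := toeplitz_surjective Lg (ex_intro _ c (conj c0 Tc)) Ig.
(* [S] has to be total, so it takes the value 0 outside [H2]. *)
have /choice[S HS] : forall u, exists f, H2 u -> H2 f /\ toeplitz g f u.
  move=> u; have [Hu|Hu] := pselect (H2 u); last by exists 0.
  by have [f Hf] := Sg _ Hu; exists f.
exists S; split; [by move=> u /HS[]|split; last split].
- exists c^-1 => u Hu; have [HSu TSu] := HS _ Hu.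
  by rewrite ler_pdivlMl//; exact: Tc.
- move=> f u Hf Tu; have [HSu TSu] := HS _ Tu.1.
  apply/ae_eq_sqnP; [exact: HSu.1|exact: Hf.1|].
  have TB := toeplitzB Lg HSu.1 Hf.1 TSu Tu.
  have HB := H2B HSu Hf.
  apply: sqn_ae_zero; first exact: HB.1.1.
  apply: (bounded_below_injective (ex_intro _ c (conj c0 Tc)) HB TB).
  by apply: aeW => x _; rewrite -[LHS]/(u x - u x) subrr.
- by move=> u /HS[].
Qed.

Lemma invertible_riesz g : Linf g -> toeplitz_invertible g -> riesz_basis_fam (Fam g).
Proof.
move=> Lg [S [HS [[K SK] [Sf SS]]]]; have Lg' := Linf_conj Lg.
pose K' := `|K| + 1; have K0 : 0 < K' by rewrite ltr_wpDl.
have bb : toeplitz_bounded_below g.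
  exists K'^-1; split; first by rewrite invr_gt0.
  move=> f u Hf Tu; rewrite ler_pdivrMl//.
  apply: (ae_eq_l2norm_le Hf.1 (HS _ Tu.1).1 _ (SK _ Tu.1)).
  exact: Sf.
split; first exact: bounded_below_frame.
have Sg u : H2 u -> exists f, H2 f /\ toeplitz g f u.
  by move=> Hu; exists (S u); split; [exact: HS|exact: SS].
(* Duality: [sqn f] is the inner product of [T_g (S f)] with [f], so its modulus is that of the
   inner product of [S f] with [T_(conj g) f]. Cauchy-Schwarz and the bound on [S] conclude. *)
have bb' : toeplitz_bounded_below (conjf g).
  exists K'^-1; split; first by rewrite invr_gt0.
  move=> f u Hf Tu; rewrite ler_pdivrMl//; have Lf := Hf.1; have Lu := Tu.1.1.
  have Hs := HS _ Hf; have Ls := Hs.1; have Ts := SS _ Hf.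
  have Lgs := L2_mul Lg Ls; have Lgf := L2_mul Lg' Lf.
  have E1 : inner f f = inner (g * S f) f.
    have := Ts.2 _ Hf; rewrite -[inner _ _]/(inner (g * S f - f) f) innerBl// => /eqP.
    by rewrite subr_eq0 => /eqP.
  have E2 : inner (conjf g * f) (S f) = inner u (S f).
    have := Tu.2 _ Hs; rewrite -[inner _ _]/(inner (conjf g * f - u) (S f)) innerBl//.
    by move=> /eqP; rewrite subr_eq0 => /eqP.
  have : sqn f <= l2norm u * l2norm (S f).
    rewrite -Re_inner_self E1 inner_mull inner_conj// E2 ReImE.
    exact: Re_inner_le.
  have sK : l2norm (S f) <= K' * l2norm f.
    apply: le_trans (SK _ Hf) _; rewrite ler_wpM2r ?l2norm_ge0//.
    by rewrite (le_trans (ler_norm _))// lerDl.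
  rewrite -sqr_l2norm; have := l2norm_ge0 f; have u0 := l2norm_ge0 u.
  rewrite le_eqVlt => /predU1P[<- _|f0 H]; first by rewrite mulr_ge0// ltW.
  rewrite -(ler_pM2r f0) -expr2; apply: le_trans H _.
  by rewrite [K' * _]mulrC -mulrA ler_wpM2l.
(* Surjectivity of [T_(conj g)] will give existence of expansions; that of [T_g] gives the
   biorthogonal functions, hence uniqueness. *)
have Sg' := toeplitz_surjective Lg' bb'.
rewrite conjfK in Sg'; move: Sg' => /(_ (bounded_below_injective bb)) Sg'.
move=> f Lf.
have [U TU] := Pplus_exists (L2_flip Lf).
have /(is_PplusP _ (L2_flip Lf))[HU UE] := TU.
have [W [HW TW]] := Sg' _ HU; have LW := HW.1; have Lw := L2_flip LW.
have Lgw := L2_mul Lg Lw.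
have w0 n : 0 <= n -> fcoef (flip W) n = 0 by exact: fcoef_flip_H2.
(* The equation [T_(conj g) W = P_+ (flip f)], read through the flip, says that [g * flip W] and [f]
   have the same negative Fourier coefficients. *)
have Hd : H2 (f - g * flip W).
  split; first exact: L2B.
  move=> n n0; rewrite fcoefB// -{1}(conjfK g) fcoef_mul_flip//.
  have /(toeplitzP _ Lg' LW)[_ <-] := TW; rewrite ?flip_index_ge0//.
  by rewrite UE ?flip_index_ge0// fcoef_flip// flip_indexK conjCK subrr.
have ex := expansion_Fam Lg Lf Lw w0 Hd.
eexists; split; first exact: ex.
move=> b exb; apply/funext => m.
have [k [Lk Hk]] := biorthogonal_Fam m Lg Sg.
rewrite (expansion_coef (fun n => L2_Fam n Lg) Lf Lk Hk exb).
by rewrite -(expansion_coef (fun n => L2_Fam n Lg) Lf Lk Hk ex).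
Qed.

End main.

Theorem theorem1p1 (R : realType) (g : R -> R[i]) :
  Linf g ->
  (complete_fam (Fam g) <-> toeplitz_injective g) /\
  (frame_fam (Fam g) <-> toeplitz_bounded g /\ toeplitz_bounded_below g) /\
  (riesz_basis_fam (Fam g) <-> toeplitz_bounded g /\ toeplitz_invertible g).
Proof.
move=> Lg; have Tb := toeplitz_bounded_Linf Lg; split; last split.
- exact: complete_iff_injective.
- by split=> [/(frame_bounded_below Lg)|[_ /(bounded_below_frame Lg)]].
- by split=> [/(riesz_invertible Lg)|[_ /(invertible_riesz Lg)]].
Qed.
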